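(* Let $\mathfrak{L}$ be a left Leibniz algebra over a field $\mathbb{F}$ of characteristic zero. Then the following statements are equivalent: (i) $\mathfrak{L}$ is finite-dimensional simple. (ii) There exists a finite-dimensional simple Lie subalgebra $\mathfrak{g}$ of $\mathfrak{L}$ such that $\mathfrak{L}=\mathfrak{g}\oplus\mathrm{Leib}(\mathfrak{L})$ (as vector spaces), and either $\mathrm{Leib}(\mathfrak{L})=0$ or $\mathrm{Leib}(\mathfrak{L})$ is a non-trivial finite-dimensional irreducible anti-symmetric $\mathfrak{g}$-bimodule. (iii) $\mathfrak{L}$ is a finite-dimensional simple Lie algebra or $\mathfrak{L}$ is isomorphic to the left hemi-semidirect product $\mathfrak{g}\ltimes_\ell M$ of a finite-dimensional simple Lie algebra $\mathfrak{g}$ over $\mathbb{F}$ and a non-trivial finite-dimensional irreducible left $\mathfrak{g}$-module $M$.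
   Context: A left Leibniz algebra is an $\mathbb{F}$-vector space $\mathfrak{L}$ with a bilinear multiplication satisfying $x(yz)=(xy)z+y(xz)$ for all $x,y,z\in\mathfrak{L}$. Ideals are two-sided. The Leibniz kernel is the ideal $\mathrm{Leib}(\mathfrak{L}):=\langle x^2\mid x\in\mathfrak{L}\rangle_{\mathbb{F}}$ and the derived subalgebra is $\mathfrak{L}^2:=\langle xy\mid x,y\in\mathfrak{L}\rangle_{\mathbb{F}}$ (linear spans). A left Leibniz algebra $\mathfrak{L}$ is simple if $0$, $\mathrm{Leib}(\mathfrak{L})$, $\mathfrak{L}$ are the only ideals of $\mathfrak{L}$, and $\mathrm{Leib}(\mathfrak{L})\subsetneqq\mathfrak{L}^2$; for Lie algebras this is the usual notion (non-abelian, no ideals other than $0$ and itself). A Lie subalgebra of $\mathfrak{L}$ is a subalgebra that is a Lie algebra under the multiplication of $\mathfrak{L}$. A bimodule over a left Leibniz algebra $\mathfrak{L}$ is a vector space $M$ with bilinear left and right actions such that for all $x,y\in\mathfrak{L}$, $m\in M$: $(xy)\cdot m=x\cdot(y\cdot m)-y\cdot(x\cdot m)$, $(x\cdot m)\cdot y=x\cdot(m\cdot y)-m\cdot(xy)$, and $(m\cdot x)\cdot y=m\cdot(xy)-x\cdot(m\cdot y)$. It is anti-symmetric if its right action is zero, and trivial if both actions are zero (non-trivial otherwise). A subalgebra $\mathfrak{g}$ of $\mathfrak{L}$ acts on $\mathrm{Leib}(\mathfrak{L})$ by left and right multiplication in $\mathfrak{L}$. A left module is trivial if its left action is zero, and non-trivial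 otherwise. Irreducible (bi)modules are by definition non-zero. For a Lie algebra $\mathfrak{g}$ and a left $\mathfrak{g}$-module $M$, the left hemi-semidirect product $\mathfrak{g}\ltimes_\ell M$ is the left Leibniz algebra with underlying vector space $\mathfrak{g}\times M$ and multiplication $(g,m)(g',m'):=([g,g'],g\cdot m')$. *)

(* Defs.v *)
From HB Require Import structures.
From mathcomp Require Import all_boot all_order all_algebra.
From mathcomp Require Import boolp classical_sets.

Set Implicit Arguments.
Unset Strict Implicit.
Unset Printing Implicit Defensive.
Import GRing.Theory.
Local Open Scope classical_set_scope.
Local Open Scope ring_scope.

(* Vector spaces over F are arbitrary (possibly infinite-dimensional)         *)
(* lmodTypes, with subspaces as classical sets. As for subgroups in MathComp, *)
(* subalgebras and the modules they act on are subsets of an ambient type;    *)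
(* a whole algebra L is the case A = [set: L].                                *)

Section LinearSubspaces.
Variables (F : fieldType) (V : lmodType F).

Definition subspace (A : set V) : Prop := submod_closed (mem A).

Definition linspan (X : set V) : set V := smallest subspace X.

Definition finite_dim (A : set V) : Prop :=
  exists s : seq V, A = linspan [set` s].

Definition direct_sum (A B : set V) : Prop :=
  [/\ subspace A, subspace B, A `&` B = [set 0]
    & forall x, exists a b, [/\ A a, B b & x = a + b]].

End LinearSubspaces.

Section Algebras.
Variables (F : fieldType) (L : lmodType F) (mul : {bilinear L -> L -> L}).
Implicit Types A I : set L.

Definition left_leibniz : Prop :=
  forall x y z, mul x (mul y z) = mul (mul x y) z + mul y (mul x z).

Definition subalgebra A : Prop :=
  subspace A /\ forall x y, A x -> A y -> A (mul x y).

Definition ideal A I : Prop :=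
  [/\ subspace I, I `<=` A
    & forall x y, A x -> I y -> I (mul x y) /\ I (mul y x)].

Definition Leib : set L := linspan [set mul x x | x in [set: L]].

Definition derived : set L :=
  linspan [set mul x y | x in [set: L] & y in [set: L]].

Definition simple_leibniz : Prop :=
  (forall I, ideal [set: L] I -> [\/ I = [set 0], I = Leib | I = [set: L]])
  /\ Leib `<` derived.

Definition lie_subalgebra A : Prop :=
  [/\ subalgebra A,
      forall x, A x -> mul x x = 0
    & forall x y z, A x -> A y -> A z ->
        mul x (mul y z) + mul y (mul z x) + mul z (mul x y) = 0].

Definition simple_lie A : Prop :=
  [/\ lie_subalgebra A,
      exists x y, [/\ A x, A y & mul x y <> 0]
    & forall I, ideal A I -> I = [set 0] \/ I = A].

End Algebras.

Definition algebra_iso (F : fieldType) (L L' : lmodType F)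
    (mul : L -> L -> L) (mul' : L' -> L' -> L') : Prop :=
  exists2 f : {linear L -> L'},
    bijective f & forall x y, f (mul x y) = mul' (f x) (f y).

Section Bimodules.
Variables (F : fieldType) (L V : lmodType F) (mul : {bilinear L -> L -> L}).
Variables (A : set L) (M : set V).
Variables (l : {bilinear L -> V -> V}) (r : {bilinear V -> L -> V}).

Definition bimodule_stable (U : set V) : Prop :=
  forall x m, A x -> U m -> U (l x m) /\ U (r m x).

Definition bimodule : Prop :=
  [/\ subspace M, bimodule_stable M
    & forall x y m, A x -> A y -> M m ->
        [/\ l (mul x y) m = l x (l y m) - l y (l x m),
            r (l x m) y = l x (r m y) - r m (mul x y)
          & r (r m x) y = r m (mul x y) - l x (r m y)]].

Definition irreducible_bimodule : Prop :=
  [/\ bimodule, M <> [set 0]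
    & forall U : set V, subspace U -> U `<=` M -> bimodule_stable U ->
        U = [set 0] \/ U = M].

Definition antisymmetric_bimodule : Prop :=
  forall x m, A x -> M m -> r m x = 0.

Definition trivial_bimodule : Prop :=
  forall x m, A x -> M m -> l x m = 0 /\ r m x = 0.

End Bimodules.

Section LeftModules.
Variables (F : fieldType) (g M : lmodType F).
Variables (br : {bilinear g -> g -> g}) (act : {bilinear g -> M -> M}).

Definition left_module : Prop :=
  forall x y m, act (br x y) m = act x (act y m) - act y (act x m).

Definition irreducible_left_module : Prop :=
  [/\ left_module, [set: M] <> [set 0]
    & forall U : set M, subspace U -> (forall x m, U m -> U (act x m)) ->
        U = [set 0] \/ U = [set: M]].

Definition trivial_left_module : Prop := forall x m, act x m = 0.

Definition hemi_semidirect (u v : g * M) : g * M :=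
  (br u.1 v.1, act u.1 v.2).

Fact hemi_semidirect_is_bilinear :
  bilinear_for *:%R *:%R hemi_semidirect.
Proof.
split=> [w a u v|w a u v]; congr pair => /=.
- exact: linearPl.
- exact: linearPl.
- exact: linearPr.
- exact: linearPr.
Qed.

HB.instance Definition _ := bilinear_isBilinear.Build F (g * M)%type
  (g * M)%type (g * M)%type *:%R *:%R hemi_semidirect
  hemi_semidirect_is_bilinear.

Fact hemi_semidirect_left_leibniz :
  lie_subalgebra br [set: g] -> left_module -> left_leibniz hemi_semidirect.
Proof.
move=> [_ xx jac] am x y z; congr pair => /=; last by rewrite am addrNK.
have anti a b : br a b = - br b a.
  apply/eqP; rewrite -addr_eq0; apply/eqP.
  have := xx (a + b) I.
  by rewrite linearDl !linearDr !xx // add0r addr0.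
have := jac x.1 y.1 z.1 I I I.
rewrite (anti z.1 x.1) linearNr (anti z.1 (br _ _)) /= => /eqP.
by rewrite -addrA -opprD subr_eq0 addrC => /eqP.
Qed.

End LeftModules.

(* Main.v *)
(* The deep implication is (i) => (ii). Left multiplication makes L a left
   module over the simple Lie algebra L / Leib L, with submodule Leib L, and a
   module complement of Leib L is automatically a subalgebra. A linear section
   of L -> L / Leib L fails to be a module map by a 1-cocycle with values in
   Hom(L / Leib L, Leib L), so the extension splits by Whitehead's first lemma.
   That lemma is proved by reducing to an irreducible module V and dividing by
   the Casimir element of the trace form of V. The trace form is nonzero when
   the action is: otherwise Cartan's argument over a splitting field makes every
   element act nilpotently on V; polarization in characteristic zero then kills
   the traces of all words in the operators, whereas an irreducible nonzero
   action would produce a nonzero idempotent in the algebra they generate. *)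
Require Import Defs.
From HB Require Import structures.
From mathcomp Require Import all_boot all_order all_algebra all_field.
From mathcomp Require Import mxrepresentation.
From mathcomp Require Import boolp classical_sets.

Set Implicit Arguments.
Unset Strict Implicit.
Unset Printing Implicit Defensive.
Import GRing.Theory Num.Theory.
Local Open Scope classical_set_scope.
Local Open Scope ring_scope.

(** * Traces and rational relations *)

Lemma mxtrace_idempotent (F : fieldType) n (e : 'M[F]_n) :
  e *m e = e -> \tr e = (\rank e)%:R.
Proof.
move=> ee; rewrite -{1}(mulmx_base e) mxtrace_mulC.
suff -> : row_base e *m col_base e = 1%:M by rewrite mxtrace1.
apply: (row_free_inj (row_base_free e));
  apply: (row_full_inj (col_base_full e)).
move: (col_base e) (row_base e) (mulmx_base e) => C R CR.
by rewrite mul1mx !mulmxA CR -mulmxA CR.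
Qed.

Lemma mxtrace_nilpotent (F : fieldType) n (a : 'M[F]_n) k :
  a ^+ k = 0 -> \tr a = 0.
Proof.
elim/ltn_ind: n k a => n IHn k a ak0.
have [fa | nfa] := boolP (row_free a).
  suff a0 : a = 0 by rewrite a0 linear0.
  elim: k ak0 => [a1|k IHk ak0]; first by rewrite -[a]mulr1 -(expr0 a) a1 mulr0.
  by apply: IHk; apply: (row_free_inj fa); rewrite /= mul0mx mulmxE -exprSr.
rewrite -(mulmx_base a) mxtrace_mulC.
have lt_r : (\rank a < n)%N by rewrite ltn_neqAle rank_leq_row andbT.
apply: (IHn _ lt_r k.+1).
suff -> j : (row_base a *m col_base a) ^+ j.+1 =
            row_base a *m a ^+ j *m col_base a :> 'M_(\rank a).
  by rewrite ak0 mulmx0 mul0mx.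
move: (col_base a) (row_base a) (mulmx_base a) => C R CR.
elim: j => [|j IHj]; first by rewrite expr1 expr0 mulmx1.
by rewrite exprSr IHj exprSr -!mulmxE !mulmxA -(mulmxA _ C) CR.
Qed.

Lemma subspace_mx (F : fieldType) n (P : 'rV[F]_n -> Prop) :
  P 0 -> (forall a u v, P u -> P v -> P (a *: u + v)) ->
  exists B : 'M[F]_n, forall v, (v <= B)%MS <-> P v.
Proof.
move=> P0 PZ.
suff step m (B : 'M[F]_n) : (n - \rank B <= m)%N ->
    (forall v : 'rV_n, (v <= B)%MS -> P v) ->
    exists C : 'M_n, forall v : 'rV_n, (v <= C)%MS <-> P v.
  apply: (step n (0 : 'M_n)) => [|v]; first by rewrite mxrank0 subn0.
  by rewrite submx0 => /eqP->.
elim: m B => [|m IHm] B rB PB.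
  exists B => v; split=> [/PB //|_]; apply: submx_full.
  by rewrite row_full_unit -row_free_unit /row_free eqn_leq rank_leq_row
    -subn_eq0 -leqn0.
have [[v [Pv nBv]]|noV] := pselect (exists v : 'rV_n, P v /\ ~ (v <= B)%MS).
  apply: (IHm (B + v)%MS) => [|w /sub_addsmxP [u ->]]; last first.
    rewrite (_ : u.2 *m v = u.2 0 0 *: v); last first.
      by rewrite [u.2]mx11_scalar mul_scalar_mx mxE eqxx mulr1n.
    by rewrite addrC; apply: PZ => //; apply/PB/submxMl.
  rewrite -ltnS; apply: leq_trans rB; rewrite ltn_sub2l //.
    rewrite ltn_neqAle rank_leq_row andbT; apply/negP => rB.
    by apply: nBv; apply: submx_full.
  by apply: rank_ltmx; rewrite /ltmx addsmxSl /=;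
    apply/negP => /(submx_trans (addsmxSr _ _)).
exists B => v; split=> [/PB //|Pv].
by apply: contrapT => nBv; apply: noV; exists v.
Qed.

Section Char0.
Variables (F : fieldType) (charF0 : [pchar F] =i pred0).

Lemma intr_eq0_char0 (z : int) : ((z%:~R : F) == 0) = (z == 0).
Proof.
case: z => n; first by rewrite -pmulrn ((pcharf0P F).1 charF0).
by rewrite NegzE mulrNz oppr_eq0 -pmulrn ((pcharf0P F).1 charF0).
Qed.

Lemma ratr_frac (x : rat) (n d : int) : d != 0 -> x * d%:~R = n%:~R ->
  ratr x = n%:~R / d%:~R :> F.
Proof.
move=> d0 xE; apply/eqP; rewrite /ratr eqr_div ?intr_eq0_char0 ?denq_neq0 //.
rewrite -!intrM; apply/eqP; congr (_%:~R); apply: (@intr_inj rat).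
by rewrite !intrM numqE mulrAC xE.
Qed.

Lemma ratrD_char0 (x y : rat) : ratr (x + y) = ratr x + ratr y :> F.
Proof.
rewrite (@ratr_frac _ (numq x * denq y + numq y * denq x) (denq x * denq y))
  ?mulf_neq0 ?denq_neq0 //.
  by rewrite /ratr addf_div ?intr_eq0_char0 ?denq_neq0 // intrD !intrM.
by rewrite intrD !intrM !numqE mulrDl; congr (_ + _); rewrite -!mulrA;
  congr (_ * _); rewrite mulrC.
Qed.

Lemma ratrM_char0 (x y : rat) : ratr (x * y) = ratr x * ratr y :> F.
Proof.
rewrite (@ratr_frac _ (numq x * numq y) (denq x * denq y)) ?mulf_neq0
  ?denq_neq0 //.
  by rewrite /ratr mulf_div !intrM.
by rewrite !intrM !numqE mulrACA.
Qed.

(* The rational relations between the [lam i] form a subspace [R]; every [phi]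
   orthogonal to [R] is such that [m * phi] lies in [R], so it vanishes wherever
   [m] does not, and hence the unit vectors there lie in [R]. *)
Lemma ratr_orthogonal k (lam : 'I_k -> F) (m : 'I_k -> nat) :
  (forall phi : 'I_k -> rat,
     (forall c : 'I_k -> rat, \sum_i ratr (c i) * lam i = 0 ->
        \sum_i c i * phi i = 0) ->
     \sum_i ratr (phi i) * lam i * (m i)%:R = 0) ->
  forall i, (0 < m i)%N -> lam i = 0.
Proof.
move=> orth i mi.
pose P (c : 'rV[rat]_k) := \sum_i ratr (c 0 i) * lam i = 0.
have r0 : ratr 0 = 0 :> F by rewrite /ratr mul0r.
have [|a u v Pu Pv|B BP] := @subspace_mx _ k P.
- by rewrite /P big1 // => j _; rewrite mxE r0 mul0r.
- rewrite /P;
    transitivity (ratr a * \sum_i ratr (u 0 i) * lam i + \sum_i ratr (v 0 i) *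
    lam i).
    rewrite mulr_sumr -big_split /=; apply: eq_bigr => j _.
    by rewrite !mxE ratrD_char0 ratrM_char0 mulrDl mulrA.
  by rewrite Pu Pv mulr0 addr0.
have col0 j : cokermx B i j = 0.
  pose phi l := cokermx B l j.
  have phiR (c : 'I_k -> rat) : \sum_i ratr (c i) * lam i = 0 -> \sum_i c i *
    phi i = 0.
    move=> c0; have : (\row_i c i <= B)%MS.
      by apply/BP; rewrite /P -[RHS]c0; apply: eq_bigr => l _; rewrite mxE.
    rewrite submxE => /eqP/matrixP/(_ 0 j); rewrite !mxE => {2}<-.
    by apply: eq_bigr => l _; rewrite mxE.
  have /eqP : \sum_l (phi l * (m l)%:R) * phi l = 0.
    apply: (phiR (fun l => phi l * (m l)%:R)).
    rewrite -[RHS](orth phi phiR); apply: eq_bigr => l _.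
    by rewrite ratrM_char0 ratr_nat mulrAC.
  rewrite psumr_eq0 => [|l _]; last first.
    by rewrite mulrAC mulr_ge0 ?ler0n // -expr2 sqr_ge0.
  move=> /allP/(_ i); rewrite mem_index_enum => /(_ isT) /=.
  by rewrite mulrAC mulf_eq0 pnatr_eq0 eqn0Ngt mi orbF -expr2 sqrf_eq0 => /eqP.
have : ((delta_mx 0 i : 'rV[rat]_k) <= B)%MS.
  by rewrite submxE -rowE; apply/eqP/rowP => j; rewrite [LHS]mxE col0 mxE.
move/BP; rewrite /P (bigD1 i) //= big1 ?addr0 => [|j ji].
  by rewrite mxE !eqxx ratr_nat mul1r.
by rewrite mxE (negPf ji) andbF r0 mul0r.
Qed.

End Char0.

(** * Cartan's criterion *)

Lemma spectral_idempotents (E : fieldType) n (T : 'M[E]_n.+1) (s : seq E) :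
  char_poly T = \prod_(z <- s) ('X - z%:P) ->
  exists (k : nat) (lam : 'I_k -> E) (e : 'I_k -> 'M[E]_n.+1) (N : nat),
    [/\ \sum_i e i = 1,
        forall i j, e i * e j = if i == j then e i else 0,
        forall i, T * e i = e i * T
      & forall i, e i * (T - (lam i)%:M) ^+ N = 0].
Proof.
move=> charT; pose t := undup s; pose k := size t; pose N := size s.
pose lam (i : 'I_k) := t`_i; pose p i := ('X - (lam i)%:P) ^+ N.
pose P := \prod_i p i; pose q i := \prod_(j | j != i) p j.
have lam_inj : injective lam.
  by move=> i j /eqP; rewrite nth_uniq ?undup_uniq // => /eqP/val_inj.
have PE i : P = p i * q i by rewrite /P (bigD1 i).
have copr i j : i != j -> coprimep (p i) (p j).
  move=> ij; rewrite coprimep_expl // coprimep_expr // coprimep_XsubC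
    root_XsubC.
  by apply: contra ij => /eqP/lam_inj->.
have copr_prod i (r : seq 'I_k) Q : ~~ has (fun j => (j == i) && Q j) r ->
    coprimep (p i) (\prod_(j <- r | Q j) p j).
  elim: r => [|j r IHr] /=; first by rewrite big_nil coprimep1.
  rewrite negb_or big_cons => /andP[ji /IHr cr].
  case: (boolP (Q j)) ji => // _; rewrite andbT => ji.
  by rewrite coprimepMr cr andbT copr // eq_sym.
have dvdP (f : {poly E}) : (forall i, p i %| f) -> P %| f.
  move=> pf; rewrite /P;
    elim: (index_enum _) (index_enum_uniq 'I_k) => [|i r IHr] /=.
    by rewrite big_nil dvd1p.
  move=> /andP[ir /IHr fr]; rewrite big_cons Gauss_dvdp ?pf // copr_prod //.
  by apply/hasPn => j jr; rewrite andbT; apply: contraNneq ir => <-.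
have PT f : P %| f -> horner_mx T f = 0.
  suff charP : char_poly T %| P.
    move=> Pf; have /dvdpP[g ->] := dvdp_trans charP Pf.
    by rewrite rmorphM /= Cayley_Hamilton mulr0.
  rewrite charT -(prodr_undup_exp_count s predT) /P (big_nth 0) big_mkord /=.
  apply: (big_ind2 (fun f g => f %| g)) => // [*|i _]; first exact: dvdp_mul.
  by rewrite dvdp_exp2l // count_size.
have bez i : exists u : {poly E} * {poly E}, u.1 * p i + u.2 * q i = 1.
  apply/Bezout_eq1_coprimepP; apply: copr_prod.
  by apply/hasPn => j _; rewrite andbN.
have [u uE] := choice bez; pose ep i := (u i).2 * q i.
have epE i : ep i = 1 - (u i).1 * p i by rewrite -(uE i) addrC addKr.
have p_ep i j : i != j -> p i %| ep j.
  move=> ij; rewrite dvdp_mull // /q (bigD1 i) //= dvdp_mulr //.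
exists k, lam, (fun i => horner_mx T (ep i)), N; split.
- rewrite -rmorph_sum /=; apply/eqP; rewrite -subr_eq0 -(rmorph1 (horner_mx T)).
  rewrite -rmorphB; apply/eqP/PT/dvdP => i.
  rewrite (bigD1 i) //= addrAC dvdp_add //.
    by rewrite epE addrAC subrr sub0r dvdpNr dvdp_mull.
  apply: (big_ind (fun f => p i %| f)) => [|f g|j]; rewrite ?dvdp0 //.
    exact: dvdp_add.
  by rewrite eq_sym => /p_ep.
- move=> i j; rewrite -rmorphM; case: eqP => [->|/eqP ij].
    apply/eqP; rewrite -subr_eq0 -rmorphB /=; apply/eqP/PT.
    rewrite -{3}[ep j]mulr1 -mulrBr {2}epE addrAC subrr sub0r mulrN dvdpNr.
    by rewrite mulrACA (PE j) [p j * _]mulrC dvdp_mull.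
  apply/PT; rewrite (PE j).
  by apply: dvdp_mul; [rewrite p_ep // eq_sym | rewrite dvdp_mull].
- by move=> i; rewrite -{1 4}(horner_mx_X T) -!rmorphM mulrC.
- move=> i; have -> : (T - (lam i)%:M) ^+ N = horner_mx T (p i).
    by rewrite rmorphXn rmorphB /= horner_mx_X horner_mx_C.
  by rewrite -rmorphM; apply/PT; rewrite (PE i) mulrC -mulrA dvdp_mull.
Qed.

Lemma iter_add_nilpotent (V : zmodType) (f g : V -> V) i j v :
  {morph f : u w / u + w} -> {morph g : u w / u + w} ->
  (forall u, f (g u) = g (f u)) ->
  iter i f v = 0 -> iter j g v = 0 ->
  iter (i + j) (fun u => f u + g u) v = 0.
Proof.
move=> fD gD fg; pose h u := f u + g u.
have f0 : f 0 = 0 by apply: (addrI (f 0)); rewrite -fD !addr0.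
have g0 : g 0 = 0 by apply: (addrI (g 0)); rewrite -gD !addr0.
have hD : {morph h : u w / u + w} by move=> u w; rewrite /h fD gD addrACA.
have h0 : h 0 = 0 by rewrite /h f0 g0 addr0.
have itD m u w : iter m h (u + w) = iter m h u + iter m h w.
  by elim: m => //= m ->; rewrite hD.
have it0 m : iter m h 0 = 0 by elim: m => //= m ->.
have comm_iter (a b : V -> V) m u :
    (forall w, a (b w) = b (a w)) -> iter m a (b u) = b (iter m a u).
  by move=> ab; elim: m => //= m ->; rewrite ab.
move: {2}(i + j)%N (erefl (i + j)%N) => m; rewrite -/h.
elim: m i j v => [|m IHm] i j v.
  by move=> /eqP; rewrite addn_eq0 => /andP[/eqP-> _] /= v0 _; rewrite v0 it0.
case: i => [|i]; first by move=> _ /= -> _; rewrite it0.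
case: j => [|j]; first by move=> _ _ /= ->; rewrite it0.
move=> ijm fv gv; rewrite addSn iterSr {1}/h itD (IHm i j.+1) //; last 3 first.
- by rewrite addSn in ijm; case: ijm.
- by rewrite -iterSr.
- by rewrite comm_iter ?gv ?f0 // => w; rewrite fg.
rewrite add0r addnS -addSn (IHm i.+1 j) //; first by rewrite addSn -addnS;
  case: ijm; rewrite addnS.
- by rewrite comm_iter ?fv ?g0.
- by rewrite -iterSr.
Qed.

Definition mxlin (F : fieldType) r m n (rho : 'I_r -> 'M[F]_(m, n))
  (x : 'rV[F]_r) : 'M[F]_(m, n) := \sum_k x 0 k *: rho k.

Lemma mxlin_is_linear (F : fieldType) r m n (rho : 'I_r -> 'M[F]_(m, n)) :
  linear (mxlin rho).
Proof.
move=> a x y; rewrite /mxlin scaler_sumr -big_split; apply: eq_bigr => k _.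
by rewrite !mxE scalerDl scalerA.
Qed.

HB.instance Definition _ (F : fieldType) r m n (rho : 'I_r -> 'M[F]_(m, n)) :=
  GRing.isLinear.Build F _ _ _ (mxlin rho) (mxlin_is_linear rho).

Lemma mxlin_delta (F : fieldType) r m n (rho : 'I_r -> 'M[F]_(m, n)) i :
  mxlin rho (delta_mx 0 i) = rho i.
Proof.
rewrite /mxlin (bigD1 i) //= big1 ?addr0 => [|j ji].
  by rewrite mxE !eqxx scale1r.
by rewrite mxE (negPf ji) andbF scale0r.
Qed.

Definition linear_pack (R : pzRingType) (U V : lmodType R) (f : U -> V)
  (_ : linear f) : U -> V := f.

HB.instance Definition _ (R : pzRingType) (U V : lmodType R) (f : U -> V)
    (lf : linear f) :=
  GRing.isLinear.Build R U V *:%R (linear_pack lf) lf.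

(* The operators [rho k] act on row vectors from the right, which reverses the
   order of composition;
     row [i] of [A k] holds the coordinates of [e_k, e_i]. *)
Definition mxrep (F : fieldType) r n (A : 'I_r -> 'M[F]_r)
    (rho : 'I_r -> 'M[F]_n) :=
  forall i k, rho i *m rho k - rho k *m rho i = mxlin rho (row i (A k)).

Lemma mxrep_lin (F : fieldType) r n (A : 'I_r -> 'M[F]_r)
    (rho : 'I_r -> 'M[F]_n) x y : mxrep A rho ->
  mxlin rho y *m mxlin rho x - mxlin rho x *m mxlin rho y =
    mxlin rho (y *m mxlin A x).
Proof.
move=> rhoP; rewrite {1 4}/mxlin. rewrite mulmx_suml mulmx_sumr -sumrB.
rewrite [y in RHS]row_sum_delta mulmx_suml linear_sum; apply: eq_bigr => i _.
rewrite -scalemxAl -scalemxAr -scalerBr -scalemxAl linearZ; congr (_ *: _).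
rewrite {1 2}/mxlin mulmx_suml mulmx_sumr -sumrB -rowE.
rewrite /mxlin -/(mxlin rho _) linear_sum linear_sum; apply: eq_bigr => k _.
by rewrite -scalemxAl -scalemxAr -scalerBr rhoP !linearZ.
Qed.

(* Elements of ad-weight [c] shift the generalized eigenvalues of [X] by [c]. *)
Lemma mul_eigen_eq0 (E : fieldType) n (X e f a : 'M[E]_n.+1) (l m c : E) N M :
  X * e = e * X -> X * f = f * X ->
  e * (X - l%:M) ^+ N = 0 -> f * (X - m%:M) ^+ N = 0 ->
  iter M (fun b : 'M_n.+1 => c *: b - (b * X - X * b)) a = 0 ->
  c != m - l -> e * a * f = 0.
Proof.
move=> Xe Xf el fm ac cml.
pose R (b : 'M_n.+1) : 'M_n.+1 := b * (X - m%:M).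
pose L (b : 'M_n.+1) : 'M_n.+1 := - ((X - l%:M) * b).
pose U (b : 'M_n.+1) : 'M_n.+1 := R b + L b.
pose T (b : 'M_n.+1) : 'M_n.+1 := c *: b - (b * X - X * b).
have RD : {morph R : u w / u + w} by move=> u w; rewrite /R mulrDl.
have LD : {morph L : u w / u + w} by move=> u w; rewrite /L mulrDr opprD.
have UD : {morph U : u w / u + w} by move=> u w; rewrite /U RD LD addrACA.
have RL u : R (L u) = L (R u) by rewrite /R /L mulNr mulrA.
have UE u : U u = (u * X - X * u) - (m - l) *: u.
  rewrite /U /R /L mulrBr mulrBl -!mulmxE mul_mx_scalar mul_scalar_mx scalerBl.
  by rewrite !opprB addrACA [RHS]addrACA; congr (_ + _); exact: addrC.
have TE u : T u = (c - (m - l)) *: u - U u.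
  by rewrite UE; move: (m - l) => g; rewrite opprB scalerBl addrA subrK.
have [d dE] : exists d, d = c - (m - l) by exists (c - (m - l)).
rewrite -dE in TE; have TD : {morph T : u w / u + w}.
  by move=> u w; rewrite !TE scalerDr UD [- (_ + _)]opprD addrACA.
have UZ k u : U (k *: u) = k *: U u.
  by rewrite !UE -scalerAl -scalerAr -scalerBr [RHS]scalerBr !scalerA [k *
    _]mulrC.
have UT u : U (T u) = T (U u).
  rewrite !TE UD UZ; congr (_ + _).
  by rewrite -scaleN1r UZ scaleN1r.
pose v := e * a * f.
have Uv : iter (N + N) U v = 0.
  apply: iter_add_nilpotent => //.
  - have -> : iter N R v = v * (X - m%:M) ^+ N.
      elim: N {el fm} => [|N IHN]; first by rewrite mulr1.
      by rewrite iterS IHN /R exprSr mulrA.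
    by rewrite /v -mulrA fm mulr0.
  - have -> : iter N L v = (-1) ^+ N *: ((X - l%:M) ^+ N * v).
      elim: N {el fm} => [|N IHN]; first by rewrite scale1r mul1r.
      by rewrite iterS IHN /L -scalerAr -scaleN1r scalerA -exprS mulrA -exprS.
    have -> : (X - l%:M) ^+ N * v = e * (X - l%:M) ^+ N * a * f.
      rewrite /v !mulrA; congr (_ * _ * _); apply/commr_sym/commrX/commrB => //.
      exact: comm_mx_scalar.
    by rewrite el !mul0r scaler0.
have Tv : iter M T v = 0.
  have TM u : T (e * u * f) = e * T u * f.
    rewrite /T !(mulrBr, mulrBl) -scalerAr -scalerAl; congr (_ - (_ - _)).
      by rewrite -!mulrA Xf.
    by rewrite !mulrA Xe.
  suff -> : iter M T v = e * iter M T a * f by rewrite ac mulr0 mul0r.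
  by elim: M {ac} => //= M ->.
have := iter_add_nilpotent UD TD UT Uv Tv.
rewrite (eq_iter (f' := fun u => d *: u)) => [|u]; last first.
  by rewrite TE addrC subrK.
have -> K : iter K (fun u => d *: u) v = d ^+ K *: v.
  elim: K => [|K IHK]; first by rewrite scale1r.
  by rewrite iterS IHK scalerA exprS.
by move/eqP; rewrite scaler_eq0 expf_eq0 dE subr_eq0 (negPf cml) andbF => /eqP.
Qed.

Definition mxperfect (F : fieldType) r (A : 'I_r -> 'M[F]_r) :=
  exists W : 'I_r -> 'M[F]_r, \sum_k W k *m A k = 1%:M.

Lemma mxperfect_linear_eq0 (F : fieldType) r (V : lmodType F)
    (A : 'I_r -> 'M[F]_r) (f : 'rV[F]_r -> V) :
  mxperfect A -> linear f -> (forall i k, f (row i (A k)) = 0) ->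
  forall x, f x = 0.
Proof.
move=> [W W1] lf fA x.
have [g gf] : exists g : {linear 'rV[F]_r -> V}, f = g by exists (linear_pack
  lf).
rewrite {}gf in fA *;
  rewrite -[x]mulmx1 -W1 mulmx_sumr linear_sum big1 // => k _.
rewrite mulmxA mulmx_sum_row linear_sum big1 // => i _.
by rewrite linearZ fA /= scaler0.
Qed.

(* [\sum_i ratr (phi i) *: e i] is the image of the semisimple part of [X] under
   an additive functional on its eigenvalues, which [phi] represents as it
   respects their rational relations. *)
Lemma commutator_semisimple_part (E : fieldType) (charE0 : [pchar E] =i pred0)
    n k (X a : 'M[E]_n.+1) (lam : 'I_k -> E) (e : 'I_k -> 'M[E]_n.+1) N M
    (phi : 'I_k -> rat) c :
  \sum_i e i = 1 ->
  (forall i j, e i * e j = if i == j then e i else 0) ->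
  (forall i, X * e i = e i * X) ->
  (forall i, e i * (X - (lam i)%:M) ^+ N = 0) ->
  (forall d : 'I_k -> rat, \sum_i ratr (d i) * lam i = 0 ->
     \sum_i d i * phi i = 0) ->
  iter M (fun b : 'M_n.+1 => c *: b - (b * X - X * b)) a = 0 ->
  exists g : E, a * (\sum_i ratr (phi i) *: e i) - (\sum_i ratr (phi i) *: e i)
    * a
     = g *: a.
Proof.
move=> e1 ee Xe eN phiR ac; set S := \sum_i _.
have eS i : e i * S = ratr (phi i) *: e i.
  rewrite /S mulr_sumr (bigD1 i) //= big1 ?addr0 => [|j ji].
    by rewrite -scalerAr ee eqxx.
  by rewrite -scalerAr ee eq_sym (negPf ji) scaler0.
have Se i : S * e i = ratr (phi i) *: e i.
  rewrite /S mulr_suml (bigD1 i) //= big1 ?addr0 => [|j ji].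
    by rewrite -scalerAl ee eqxx.
  by rewrite -scalerAl ee (negPf ji) scaler0.
have split_e (b : 'M[E]_n.+1) : b = \sum_i \sum_j e i * b * e j.
  rewrite -[LHS]mulr1 -[b in LHS]mul1r -e1 mulr_suml mulr_suml.
  by apply: eq_bigr => i _; rewrite mulr_sumr.
have [g gP] : exists g : E, forall i j, c = lam j - lam i ->
    ratr (phi j) - ratr (phi i) = g.
  have [[i0 [j0 cE]]|no] := pselect (exists i j, c = lam j - lam i); last first.
    by exists 0 => i j cE; case: no; exists i, j.
  exists (ratr (phi j0) - ratr (phi i0)) => i j cE'.
  pose d l : rat := (l == j)%:R - (l == i)%:R - ((l == j0)%:R - (l == i0)%:R).
  have rD := ratrD_char0 charE0.
  have rN x : ratr (- x) = - ratr x :> E.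
    by apply/eqP; rewrite -addr_eq0 -rD addNr /ratr mul0r.
  have sum_delta (R : comNzRingType) (f : 'I_k -> R) l0 : \sum_l (l == l0)%:R *
    f l = f l0.
    rewrite (bigD1 l0) //= eqxx mul1r big1 ?addr0 // => l /negPf->.
    by rewrite mul0r.
  have : \sum_l d l * phi l = 0.
    apply: phiR; transitivity (\sum_l ((l == j)%:R * lam l - (l == i)%:R * lam l
        - ((l == j0)%:R * lam l - (l == i0)%:R * lam l))).
      by apply: eq_bigr => l _; rewrite /d !(rD, rN, ratr_nat) -!mulrBl.
    by rewrite !sumrB !sum_delta -cE' -cE subrr.
  rewrite (eq_bigr (fun l => ((l == j)%:R * phi l - (l == i)%:R * phi l
        - ((l == j0)%:R * phi l - (l == i0)%:R * phi l)))) => [|l _];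
            last first.
    by rewrite /d -!mulrBl.
  rewrite !sumrB !sum_delta => /eqP; rewrite subr_eq0 => /eqP phiE.
  by rewrite -!rN -!rD phiE.
exists g; rewrite [a in RHS]split_e [LHS]split_e scaler_sumr.
apply: eq_bigr => i _; rewrite scaler_sumr; apply: eq_bigr => j _.
have -> : e i * (a * S - S * a) * e j = (ratr (phi j) - ratr (phi i)) *: (e i *
  a * e j).
  rewrite mulrBr mulrBl !mulrA eS -!mulrA Se !mulrA.
  by rewrite -!scalerAl -!scalerAr scalerBl.
have [/gP-> //|cE] := eqVneq c (lam j - lam i).
by rewrite (mul_eigen_eq0 (Xe i) (Xe j) (eN i) (eN j) ac) ?scaler0.
Qed.

Lemma trace_form0_nilpotent_split (E : fieldType) (charE0 : [pchar E] =i pred0)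
    r n (A : 'I_r.+1 -> 'M[E]_r.+1) (rho : 'I_r.+1 -> 'M[E]_n.+1)
    (x : 'rV[E]_r.+1) (s t : seq E) :
  mxperfect A -> mxrep A rho -> (forall i j, \tr (rho i *m rho j) = 0) ->
  char_poly (mxlin rho x) = \prod_(z <- s) ('X - z%:P) ->
  char_poly (mxlin A x) = \prod_(z <- t) ('X - z%:P) ->
  exists N, mxlin rho x ^+ N = 0.
Proof.
move=> perfA rhoP tr0 Xs At; set X := mxlin rho x in Xs *.
have [k [lam [e [N [e1 ee Xe eN]]]]] := spectral_idempotents Xs.
have [k' [mu [e' [N' [e'1 _ Ae' eN']]]]] := spectral_idempotents At.
have tre i : \tr (e i) = (\rank (e i))%:R.
  by apply: mxtrace_idempotent; rewrite mulmxE ee eqxx.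
have trXe i : \tr (X * e i) = lam i * (\rank (e i))%:R.
  have : \tr (e i * (X - (lam i)%:M)) = 0.
    apply: (@mxtrace_nilpotent _ _ _ N.+1).
    have cX : GRing.comm (e i) (X - (lam i)%:M).
      by apply: commrB; [apply/commr_sym/Xe | apply: comm_mx_scalar].
    have eX m : e i ^+ m.+1 = e i.
      by elim: m => // m IHm; rewrite exprS IHm ee eqxx.
    by rewrite exprMn_comm // eX exprSr mulrA eN mul0r.
  rewrite mulrBr linearB /= -Xe => /eqP; rewrite subr_eq0 => /eqP->.
  by rewrite -mulmxE mul_mx_scalar linearZ /= tre.
have lam0 i : (0 < \rank (e i))%N -> lam i = 0.
  apply: (ratr_orthogonal charE0 (m := fun i => \rank (e i))) => phi phiR.
  have [S SE] : exists S, S = \sum_i ratr (phi i) *: e i by eexists.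
  transitivity (\tr (X *m S)).
    rewrite SE mulmx_sumr linear_sum; apply: eq_bigr => j _.
    by rewrite -scalemxAr linearZ /= trXe mulrA.
  have trS i0 y : \tr (rho i0 *m (mxlin rho y *m S - S *m mxlin rho y)) = 0.
    have -> : mxlin rho y = \sum_j mxlin rho (y *m e' j).
      by rewrite -linear_sum -mulmx_sumr e'1 mulmx1.
    rewrite mulmx_suml mulmx_sumr -sumrB mulmx_sumr linear_sum big1 // => j _.
    have [|g gE] := commutator_semisimple_part charE0 (a := mxlin rho (y *m e'
      j))
       (c := mu j) (M := N') e1 ee Xe eN phiR.
      have -> : iter N' (fun b : 'M_n.+1 => mu j *: b - (b * X - X * b))
          (mxlin rho (y *m e' j)) =
          mxlin rho ((-1) ^+ N' *: (y *m (e' j *m (mxlin A x - (mu j)%:M) ^+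
            N'))).
        elim: (N') => [|K IHK]; first by rewrite scale1r mulmx1.
        rewrite iterS IHK -!mulmxE (mxrep_lin _ _ rhoP) -linearZ -linearB /=;
          congr (mxlin rho _).
        rewrite -scalemxAl scalerA [mu j * _]mulrC -scalerA -scalerBr exprS
          mulN1r scaleNr -scalerN.
        rewrite -[mu j *: _ - _]opprB exprSr -mulmxE (mulmxA (e' j)).
        by rewrite (mulmxA y (_ *m _)) mulmxBr mul_mx_scalar.
      by rewrite mulmxE eN' mulmx0 scaler0 linear0.
    rewrite !mulmxE SE gE -scalerAr linearZ /= -mulmxE {1}/mxlin mulmx_sumr
      linear_sum.
    by rewrite big1 ?mulr0 // => l _; rewrite -scalemxAr linearZ /= tr0 mulr0.
  apply: (@mxperfect_linear_eq0 _ _ E^o A (fun y =>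
    \tr (mxlin rho y *m S))) => //.
    by move=> a u v; rewrite linearP mulmxDl -scalemxAl linearP.
  move=> i0 k0; rewrite -rhoP mulmxBl linearB /= -[RHS](trS i0 (delta_mx 0 k0)).
  rewrite mxlin_delta mulmxBr linearB /= mulmxA; congr (_ - _).
  by rewrite -mulmxA mxtrace_mulC mulmxA.
exists N; rewrite -[X ^+ N]mul1r -e1 mulr_suml big1 // => i _.
have [e0|] := posnP (\rank (e i)).
  by move/eqP: e0; rewrite mxrank_eq0 => /eqP->; rewrite mul0r.
by move=> /lam0 li; have := eN i; rewrite li raddf0 subr0.
Qed.

Lemma irreducible_factor (F : fieldType) (p : {poly F}) :
  (1 < size p)%N -> exists2 q, irreducible_poly q & q %| p.
Proof.
move=> p1; pose P m := `[< exists q : {poly F}, [/\ size q = m, (1 < m)%N & q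
  %| p] >].
have exP : exists m, P m by exists (size p); apply/asboolP; exists p.
case: (ex_minnP exP) => m /asboolP[q [<- q1 qp]] mmin.
exists q => //; split=> // d d1 dq; rewrite -dvdp_size_eqp // eqn_leq.
have q0 : q != 0 by rewrite -size_poly_gt0 (ltn_trans _ q1).
rewrite dvdp_leq //=; apply: mmin; apply/asboolP; exists d; split=> //.
  by rewrite ltn_neqAle eq_sym d1 size_poly_gt0 (dvdpN0 dq).
exact: dvdp_trans qp.
Qed.

Lemma splitting_extension (F : fieldType) (p : {poly F}) : p \is monic ->
  exists (E : fieldType) (iota : {rmorphism F -> E}) (s : seq E),
    map_poly iota p = \prod_(z <- s) ('X - z%:P).
Proof.
move: {2}(size p) (leqnn (size p)) => m.
elim: m F p => [|m IHm] F p pm pmon.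
  by move: pm; rewrite leqn0 size_poly_eq0 (negPf (monic_neq0 pmon)).
have [p1|p1] := leqP (size p) 1.
  exists F, idfun, [::]; rewrite big_nil map_poly_id // (size1_polyC p1).
  move: pmon; rewrite monicE /lead_coef; move: p1 => /=.
  case: (size p) => [|[|//]] _ /eqP->; first by [].
  by [].
have [q qirr qp] := irreducible_factor p1.
have [K _ [z qz _]] := irredp_FAdjoin qirr.
have /factor_theorem[p' pE] : root (map_poly (in_alg K) p) z.
  by move: qz; rewrite -!dvdp_XsubCl => /dvdp_trans; apply; rewrite dvdp_map.
have p'mon : p' \is monic.
  by rewrite -(monicMr _ (monicXsubC z)) -pE map_monic.
have [||E [iota [s sE]]] := IHm K p' => //.
  have : size (map_poly (in_alg K) p) = (size p').+1.
    by rewrite pE size_Mmonic ?monic_neq0 ?monicXsubC // size_XsubC addn2.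
  by rewrite size_map_poly => pp'; rewrite -ltnS -pp'.
exists E, (iota \o in_alg K), (iota z :: s).
by rewrite map_poly_comp pE rmorphM /= sE rmorphB /= map_polyX map_polyC
  big_cons mulrC.
Qed.

Lemma map_mxlin (F E : fieldType) (iota : {rmorphism F -> E}) r m n
    (rho : 'I_r -> 'M[F]_(m, n)) x :
  map_mx iota (mxlin rho x) =
    mxlin (fun k => map_mx iota (rho k)) (map_mx iota x).
Proof.
rewrite raddf_sum; apply: eq_bigr => k _.
by rewrite /= map_mxZ mxE.
Qed.

Lemma trace_form0_nilpotent (F : fieldType) (charF0 : [pchar F] =i pred0)
    r n (A : 'I_r -> 'M[F]_r) (rho : 'I_r -> 'M[F]_n) (x : 'rV[F]_r) :
  mxperfect A -> mxrep A rho -> (forall i j, \tr (rho i *m rho j) = 0) ->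
  exists N, mxlin rho x ^+ N = 0.
Proof.
case: n rho => [|n] rho perfA rhoP tr0; first by exists 0; apply: flatmx0.
case: r => [|r] in A rho x perfA rhoP tr0 *.
  by exists 1; rewrite expr1 /mxlin big_ord0.
pose P : {poly F} := char_poly (mxlin rho x);
  pose Q : {poly F} := char_poly (mxlin A x).
have [Pm Qm] : P \is monic /\ Q \is monic by rewrite !char_poly_monic.
have PQm : P * Q \is monic by rewrite monicMr.
have [E [iota [s sE]]] := splitting_extension PQm.
have split (R : {poly F}) : R \is monic -> R %| P * Q ->
    exists t, map_poly iota R = \prod_(z <- t) ('X - z%:P).
  move=> Rm; rewrite -(dvdp_map iota) sE => /dvdp_prod_XsubC[m Rt].
  exists (mask m s); apply/eqP; rewrite -eqp_monic ?monic_prod_XsubC //.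
  by rewrite map_monic.
have [s1 Ps] := split P Pm (dvdp_mulr _ (dvdpp _)).
have [t1 Qt] := split Q Qm (dvdp_mull _ (dvdpp _)).
rewrite !map_char_poly !map_mxlin in Ps Qt.
have charE0 : [pchar E] =i pred0 by move=> z; rewrite (fmorph_pchar iota).
have [||| N rN] := trace_form0_nilpotent_split charE0 _ _ _ Ps Qt.
- have [W W1] := perfA; exists (fun k => map_mx iota (W k)).
  rewrite -(map_mx1 iota) -W1 raddf_sum; apply: eq_bigr => k _.
  by rewrite /= map_mxM.
- move=> i k; rewrite -!map_mxM -map_mxB rhoP map_mxlin; congr mxlin.
  by rewrite map_row.
- by move=> i j; rewrite -map_mxM trace_map_mx tr0 rmorph0.
exists N; apply: (@map_mx_inj _ _ iota _ _); rewrite map_mx0 -rN -map_mxlin.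
by rewrite rmorphXn.
Qed.

(** * Nonvanishing of the trace form *)

Lemma fitting_idempotent (F : fieldType) n (a : 'M[F]_n.+1) :
  exists (p : {poly F}) N, let e := horner_mx a (p * 'X) in
    e * e = e /\ a ^+ N * (1 - e) = 0.
Proof.
have [m [q q0 cE]] := multiplicity_XsubC (char_poly a) 0.
rewrite monic_neq0 ?char_poly_monic //= subr0 in q0 cE.
have /Bezout_eq1_coprimepP[u uE] : coprimep ('X ^+ m.+1) q.
  by rewrite coprimep_sym coprimep_expr // -['X]subr0 -polyC0 coprimep_XsubC.
exists (u.1 * 'X ^+ m), m; rewrite -mulrA -exprSr.
have e1E : 1 - horner_mx a (u.1 * 'X ^+ m.+1) = horner_mx a (u.2 * q).
  by rewrite -(rmorph1 (horner_mx a)) -rmorphB -uE addrC addKr.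
have qm0 : horner_mx a (q * 'X ^+ m) = 0 by rewrite -cE Cayley_Hamilton.
split.
  apply/eqP; rewrite -subr_eq0 -oppr_eq0 opprB -{1}[horner_mx a _]mulr1 -mulrBr
    e1E.
  rewrite -rmorphM mulrACA exprS -['X * _ * q]mulrA [_ * q]mulrC mulrA rmorphM.
  by rewrite /= qm0 mulr0.
rewrite e1E -[a in a ^+ m]horner_mx_X -rmorphXn -rmorphM mulrCA [_ * q]mulrC.
by rewrite rmorphM /= qm0 mulr0.
Qed.

Lemma char0_poly_eq0 (F : fieldType) (charF0 : [pchar F] =i pred0) (p : {poly
  F}) :
  (forall t, p.[t] = 0) -> p = 0.
Proof.
move=> p0; apply/eqP/negPn/negP => pn0.
pose rs : seq F := [seq i%:R | i <- iota 0 (size p)].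
suff : (size rs < size p)%N by rewrite size_map size_iota ltnn.
apply: max_poly_roots => //; first by apply/allP => t _; apply/eqP/p0.
rewrite map_inj_uniq ?iota_uniq // => i j /eqP.
wlog ij : i j / (i <= j)%N => [hw|].
  by case: (leqP i j) => [/hw//|/ltnW/hw h]; rewrite eq_sym => /h->.
rewrite eq_sym -subr_eq0 -natrB // ((pcharf0P F).1 charF0) subn_eq0 => ji.
by apply/eqP; rewrite eqn_leq ij.
Qed.

(* The coefficient [c 1] is the derivative of [(x + t y) ^ m] at [t = 0]. *)
Lemma expr_line_coef (F : fieldType) n (x y : 'M[F]_n.+1) m :
  exists c : nat -> 'M[F]_n.+1,
    [/\ forall t, (x + t *: y) ^+ m = \sum_(i < m.+1) t ^+ i *: c i,
        forall i, (m < i)%N -> c i = 0,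
        c 0%N = x ^+ m
      & c 1%N = \sum_(l < m) x ^+ l * y * x ^+ (m - l.+1)].
Proof.
elim: m => [|m [c [cE cm c0 c1]]].
  exists (fun i => (i == 0)%:R); split=> // [t|[|i]//|];
    last by rewrite big_ord0.
  by rewrite big_ord1 scale1r.
exists (fun i => c i * x + (if i is j.+1 then c j * y else 0));
  split=> [t|[|i] //|/=|/=].
- rewrite exprSr cE mulrDr [RHS]big_ord_recl /= addr0 expr0 scale1r.
  under [X in _ = _ + X]eq_bigr => i _ do rewrite scalerDr.
  rewrite big_split /= addrA; congr (_ + _).
    rewrite mulr_suml big_ord_recl scale1r; congr (_ + _).
    rewrite [RHS]big_ord_recr /= cm // mul0r scaler0 addr0.
    by apply: eq_bigr => i _; rewrite scalerAl.
  rewrite mulr_suml; apply: eq_bigr => i _.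
  by rewrite -scalerAr -scalerAl scalerA -exprS.
- by move=> mi; rewrite !cm ?mul0r ?addr0 // ltnW.
- by rewrite c0 addr0 exprSr.
- rewrite c0 c1 big_ord_recr /= subnn mulr1; congr (_ + _).
  rewrite mulr_suml; apply: eq_bigr => i _.
  by rewrite -mulrA -exprSr subSn.
Qed.

Lemma polarization (F : fieldType) (charF0 : [pchar F] =i pred0) n
    (G : 'M[F]_n.+1 -> Prop) :
  (forall a u v, G u -> G v -> G (a *: u + v)) ->
  (forall u v, G u -> G v -> G (u * v - v * u)) ->
  forall k (tau : {linear 'M[F]_n.+1 -> F^o}),
  (forall x j, G x -> (0 < j <= k)%N -> tau (x ^+ j) = 0) ->
  forall w : seq 'M[F]_n.+1, (forall x, x \in w -> G x) ->
    (0 < size w <= k)%N -> tau (\prod_(x <- w) x) = 0.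
Proof.
move=> GZ GB; elim=> [|k IHk] tau tau0 w; first by case: w.
have IHw v : (forall x, x \in v -> G x) ->
    (0 < size v <= k)%N -> tau (\prod_(x <- v) x) = 0.
  apply: IHk => x j Gx /andP[j0 jk]; apply: tau0 => //.
  by rewrite j0 leqW.
case/lastP: w => // w y Gw; rewrite size_rcons ltnS => /= wk.
have Gy : G y by apply: Gw; rewrite mem_rcons mem_head.
have {}Gw x : x \in w -> G x by move=> xw; apply: Gw;
  rewrite mem_rcons in_cons xw orbT.
move: wk; rewrite leq_eqVlt => /predU1P[wk|wk]; last first.
  apply: IHw => [x|]; last by rewrite size_rcons.
  by rewrite mem_rcons in_cons => /orP[/eqP->|/Gw].
have lt' : linear (fun z : 'M[F]_n.+1 => tau (z * y)).
  by move=> a u v; rewrite mulrDl -scalerAl linearP.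
case: wk => wk; case: k => [|k] in IHk tau0 IHw wk *.
  rewrite (size0nil wk) big_seq1; apply: (tau0 y 1%N) => //.
rewrite -cats1 big_cat big_seq1 /=; apply: (IHk (linear_pack lt'));
  rewrite ?wk ?leqnn //.
rewrite /linear_pack => x j Gx /andP[j0 jk].
have [c [cE _ c0 c1]] := expr_line_coef x y j.+1.
pose p := \poly_(i < j.+2) tau (c i).
have p0 : p = 0.
  apply: char0_poly_eq0 => // t.
  rewrite horner_poly; transitivity (tau ((x + t *: y) ^+ j.+1)).
    by rewrite cE linear_sum; apply: eq_bigr => i _; rewrite linearZ /= mulrC.
  by apply: tau0; [rewrite addrC; exact: GZ | rewrite ltnS].
have swap l i : (l + i)%N.+1 = j -> tau (x ^+ l * y * x ^+ i.+1) = tau (x ^+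
  l.+1 * y * x ^+ i).
  move=> lij; apply/eqP; rewrite -subr_eq0 -linearB exprS exprSr !mulrA -mulrBl.
  rewrite -!(mulrA (x ^+ l)) -mulrBr; set b := _ - _.
  have prod_nseq i' : \prod_(z <- nseq i' x) z = x ^+ i'.
    by elim: i' => [|i' IHi']; rewrite ?big_nil // big_cons IHi' exprS.
  have := IHw (nseq l x ++ b :: nseq i x);
    rewrite big_cat big_cons /= !prod_nseq.
  rewrite mulrA => ->  //.
    move=> z; rewrite mem_cat in_cons !mem_nseq.
    by move=> /or3P[/andP[_ /eqP->]|/eqP->|/andP[_ /eqP->]] //; apply: GB.
  by rewrite size_cat /= !size_nseq addnS lij j0.
have tauE l i : (l + i)%N = j -> tau (x ^+ l * y * x ^+ i) = tau (x ^+ j * y).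
  elim: i l => [|i IHi] l; first by rewrite addn0 mulr1 => ->.
  by rewrite addnS => lij; rewrite swap // IHi ?addSn.
have := congr1 (fun q : {poly F} => q`_1) p0; rewrite coef_poly coef0 /= c1.
rewrite linear_sum (eq_bigr (fun=> tau (x ^+ j * y))) => [|l _]; last first.
  by rewrite tauE // subSS subnKC // -ltnS.
rewrite sumr_const card_ord -[_ *+ _]mulr_natr => /eqP.
by rewrite mulf_eq0 ((pcharf0P F).1 charF0) orbF => /eqP.
Qed.

Section WordSpan.
Variables (F : fieldType) (charF0 : [pchar F] =i pred0) (r n : nat).
Variable rho : 'I_r -> 'M[F]_n.+1.

(* The non-unital associative algebra generated by the [rho k], described by
   the linear forms that vanish on it. *)
Definition word_span (a : 'M[F]_n.+1) : Prop :=
  forall tau : {linear 'M[F]_n.+1 -> F^o},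
    (forall w : seq 'I_r, w != [::] -> tau (\prod_(k <- w) rho k) = 0) ->
    tau a = 0.

Lemma word_span_linear c a b :
  word_span a -> word_span b -> word_span (c *: a + b).
Proof. by move=> Aa Ab tau tau0; rewrite linearP Aa ?Ab //= scaler0 addr0. Qed.

Lemma word_span_gen k : word_span (rho k).
Proof. by move=> tau /(_ [:: k] isT); rewrite big_seq1. Qed.

Lemma word_span_mul a b : word_span a -> word_span b -> word_span (a * b).
Proof.
move=> Aa Ab tau tau0.
have lb : linear (fun z : 'M[F]_n.+1 => tau (z * b)).
  by move=> c u v; rewrite mulrDl -scalerAl linearP.
apply: (Aa (linear_pack lb)) => w wn0; rewrite /linear_pack.
have lw : linear (fun z : 'M[F]_n.+1 => tau ((\prod_(k <- w) rho k) * z)).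
  by move=> c u v; rewrite mulrDr -scalerAr linearP.
apply: (Ab (linear_pack lw)) => w' w'n0; rewrite /linear_pack /=.
by have := tau0 (w ++ w'); rewrite big_cat; apply; case: w wn0 {lw}.
Qed.

Lemma word_span_horner a p : word_span a -> word_span (horner_mx a (p * 'X)).
Proof.
move=> Aa; have A0 : word_span 0 by move=> tau _; rewrite linear0.
elim/poly_ind: p => [|p c IHp]; first by rewrite mul0r rmorph0.
rewrite mulrDl rmorphD (rmorphM _ (p * 'X)) (rmorphM _ c%:P) /= horner_mx_X
  horner_mx_C.
rewrite -mulmxE mul_scalar_mx addrC; apply: word_span_linear => //.
by rewrite mulmxE; apply: word_span_mul.
Qed.

Lemma irreducible_word_trace0 :
  (forall U : 'M[F]_n.+1, (forall k, (U *m rho k <= U)%MS) ->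
     U = 0 \/ row_full U) ->
  (forall w : seq 'I_r, w != [::] -> \tr (\prod_(k <- w) rho k) = 0) ->
  forall k, rho k = 0.
Proof.
(* If [v] is not killed, irreducibility gives [v = v a] with [a] in the algebra;
   the Fitting idempotent of [a] is then nonzero but has trace zero. *)
move=> irr tr0 k; apply/row_matrixP => i; rewrite row0 rowE.
move: (delta_mx 0 i) => v {i}.
pose P (u : 'rV[F]_n.+1) := exists2 a, word_span a & u = v *m a.
have [||B BP] := @subspace_mx _ _ P.
- by exists 0; rewrite ?mulmx0 // => tau _; rewrite linear0.
- move=> c u w [a Aa ->] [b Ab ->]; exists (c *: a + b).
    exact: word_span_linear.
  by rewrite mulmxDr scalemxAr.
have Pv : P (v *m rho k) by exists (rho k) => //; apply: word_span_gen.
case: (irr B) => [j||fullB].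
- apply/row_subP => i; rewrite row_mul.
  have /BP[a Aa ->] : (row i B <= B)%MS by apply: row_sub.
  apply/BP; exists (a * rho j); last by rewrite -mulmxA.
  by apply: word_span_mul => //; apply: word_span_gen.
- by move=> B0; move/BP: Pv; rewrite B0 submx0 => /eqP.
have /BP[a Aa va] : (v <= B)%MS by apply: submx_full.
have [p [N [ee eN]]] := fitting_idempotent a.
set e := horner_mx _ _ in ee eN.
have e0 : e = 0.
  have : \tr e = 0.
    by apply: (word_span_horner p Aa (tau := mxtrace)) => w wn0; apply: tr0.
  rewrite mxtrace_idempotent // => /eqP; rewrite ((pcharf0P F).1 charF0).
  by rewrite mxrank_eq0 => /eqP.
have -> : v = v *m (a ^+ N * (1 - e)).
  rewrite e0 subr0 mulr1; elim: N {eN} => [|N IHN]; first by rewrite mulmx1.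
  by rewrite exprS -mulmxE mulmxA -va.
by rewrite eN mulmx0 mul0mx.
Qed.

End WordSpan.

Lemma irreducible_trace_form0 (F : fieldType) (charF0 : [pchar F] =i pred0)
    r n (A : 'I_r -> 'M[F]_r) (rho : 'I_r -> 'M[F]_n.+1) :
  mxperfect A -> mxrep A rho ->
  (forall U : 'M[F]_n.+1, (forall k, (U *m rho k <= U)%MS) ->
     U = 0 \/ row_full U) ->
  (forall i j, \tr (rho i *m rho j) = 0) ->
  forall k, rho k = 0.
Proof.
move=> perfA rhoP irr tr0; apply: irreducible_word_trace0 => // w wn0.
rewrite -(big_map rho predT id).
pose G (a : 'M[F]_n.+1) := exists x, a = mxlin rho x.
apply: (@polarization F charF0 n G _ _ (size w) mxtrace).
- by move=> c _ _ [x ->] [y ->]; exists (c *: x + y); rewrite linearP.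
- move=> _ _ [x ->] [y ->]; exists (x *m mxlin A y).
  by rewrite -(mxrep_lin _ _ rhoP).
- move=> _ [|j] [x ->] // _ /=.
  have [N xN] := trace_form0_nilpotent charF0 x perfA rhoP tr0.
  apply: (@mxtrace_nilpotent _ _ _ N).
  by rewrite -exprM mulnC exprM xN expr0n.
- by move=> _ /mapP[k _ ->]; exists (delta_mx 0 k); rewrite mxlin_delta.
by rewrite size_map leqnn andbT; case: w wn0.
Qed.

(** * Whitehead's first lemma *)

Lemma adapted_basis (F : fieldType) n (U : 'M[F]_n) :
  exists (C : 'M[F]_(n - \rank U, n)) (C' : 'M[F]_(n, n - \rank U))
         (K : 'M[F]_(\rank U, n)) (K' : 'M[F]_(n, \rank U)),
    [/\ C *m C' = 1%:M, C *m K' = 0, K *m C' = 0, K *m K' = 1%:M &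
        C' *m C + K' *m K = 1%:M /\ (K :=: U)%MS].
Proof.
rewrite -mxrank_coker.
exists (val_factmod 1%:M), (in_factmod U 1%:M), (val_submod 1%:M), (in_submod U
  1%:M).
rewrite -!in_factmodE -!in_submodE -!val_factmodE -!val_submodE.
rewrite val_factmodK val_submodK; split=> //.
- by apply/eqP; rewrite in_submod_eq0 val_factmodP.
- by apply/eqP; rewrite in_factmod_eq0 val_submodP.
by rewrite addrC add_sub_fact_mod; split=> //; apply: val_submod1.
Qed.

Definition mxirreducible (F : fieldType) r n (rho : 'I_r -> 'M[F]_n) :=
  forall U : 'M[F]_n, (forall k, (U *m rho k <= U)%MS) -> U = 0 \/ row_full U.

Definition mxcocycle (F : fieldType) r m n (A : 'I_r -> 'M[F]_r)
    (rho : 'I_r -> 'M[F]_n) (D : 'I_r -> 'M[F]_(m, n)) :=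
  forall i k, D i *m rho k - D k *m rho i = mxlin D (row i (A k)).

Section Casimir.
Variables (F : fieldType) (r n : nat).
Variables (A : 'I_r -> 'M[F]_r) (rho : 'I_r -> 'M[F]_n).
Hypotheses (irrA : mxirreducible A) (rhoP : mxrep A rho).

Let B : 'M[F]_r := \matrix_(i, j) \tr (rho i *m rho j).
Hypothesis B0 : B != 0.

Let G := invmx B.

Lemma trace_form_invariant k : A k *m B = - (B *m (A k)^T).
Proof.
have trlin i (M : 'M[F]_n) : \sum_l A k i l * \tr (rho l *m M)
    = \tr (mxlin rho (row i (A k)) *m M).
  rewrite mulmx_suml linear_sum; apply: eq_bigr => l _.
  by rewrite -scalemxAl linearZ /= mxE.
apply/matrixP => i j; rewrite !mxE; apply/eqP; rewrite -addr_eq0.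
under eq_bigr do rewrite mxE.
under [X in _ + X]eq_bigr do rewrite !mxE mulrC mxtrace_mulC.
have cyc (a b c : 'M[F]_n) : \tr (a *m b *m c) = \tr (b *m c *m a).
  by rewrite -mulmxA mxtrace_mulC.
rewrite !trlin -!rhoP !mulmxBl !linearB /=.
by rewrite [\tr (rho i *m _ *m _)]cyc [\tr (rho j *m _ *m _)]cyc addrA subrK
  subrr.
Qed.

Lemma trace_form_unit : B \in unitmx.
Proof.
have [k|kB|fB] := irrA (U := kermx B).
- by apply/sub_kermxP;
    rewrite -mulmxA trace_form_invariant mulmxN mulmxA mulmx_ker mul0mx oppr0.
- by rewrite -row_free_unit -kermx_eq0 kB.
by case/eqP: B0; rewrite -[B]mul1mx; apply/sub_kermxP; apply: submx_full.
Qed.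

Lemma casimir_invariant (V : lmodType F) (Phi : 'I_r -> 'I_r -> V) k :
  \sum_i \sum_j G i j *: (\sum_l A k i l *: Phi l j + \sum_l A k j l *: Phi i l)
    = 0.
Proof.
have GA : (A k)^T *m G = - (G *m A k).
  have uB := trace_form_unit.
  have <- : G *m (A k *m B) *m G = G *m A k.
    by rewrite -!mulmxA mulmxV // mulmx1.
  by rewrite trace_form_invariant mulmxN mulNmx opprK mulmxA mulVmx // mul1mx.
transitivity (\sum_p \sum_q ((A k)^T *m G + G *m A k) p q *: Phi p q);
  last first.
  by rewrite GA addNr big1 // => p _; rewrite big1 // => q _;
    rewrite mxE scale0r.
under eq_bigr => i _ do under eq_bigr => j _ do rewrite scalerDr !scaler_sumr.
under eq_bigr => i _ do rewrite big_split /=.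
under [RHS]eq_bigr => p _ do under eq_bigr => q _ do rewrite mxE scalerDl.
under [RHS]eq_bigr => p _ do rewrite big_split /=.
rewrite !big_split /=; congr (_ + _).
  rewrite exchange_big /= [RHS]exchange_big; apply: eq_bigr => q _ /=.
  rewrite exchange_big; apply: eq_bigr => p _ /=.
  rewrite mxE scaler_suml; apply: eq_bigr => i _.
  by rewrite mxE scalerA mulrC.
apply: eq_bigr => p _; rewrite exchange_big; apply: eq_bigr => q _ /=.
by rewrite mxE scaler_suml; apply: eq_bigr => j _; rewrite scalerA.
Qed.

Definition casimir : 'M[F]_n := \sum_i \sum_j G i j *: (rho j *m rho i).

Lemma casimir_cocycle m (D : 'I_r -> 'M[F]_(m, n)) k (E : 'M[F]_(m, n)) :
  (forall j, mxlin D (row j (A k)) = D j *m rho k - E *m rho j) ->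
  (\sum_i \sum_j G i j *: (D j *m rho i)) *m rho k = E *m casimir.
Proof.
move=> DE; have Phi0 := casimir_invariant (fun i j => D j *m rho i) k.
rewrite -[RHS]addr0 -[X in _ = _ + X]Phi0 {Phi0}.
rewrite /casimir mulmx_suml mulmx_sumr -big_split; apply: eq_bigr => i _ /=.
rewrite mulmx_suml mulmx_sumr -big_split; apply: eq_bigr => j _ /=.
rewrite -scalemxAl -scalemxAr -scalerDr; congr (_ *: _).
have -> : \sum_l A k i l *: (D j *m rho l) = D j *m (rho i *m rho k - rho k *m
  rho i).
  rewrite rhoP /mxlin mulmx_sumr; apply: eq_bigr => l _.
  by rewrite -scalemxAr mxE.
have -> : \sum_l A k j l *: (D l *m rho i) = (D j *m rho k - E *m rho j) *m rho
  i.
  rewrite -DE /mxlin mulmx_suml; apply: eq_bigr => l _.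
  by rewrite -scalemxAl mxE.
by rewrite mulmxBr mulmxBl !mulmxA [RHS]addrC -addrA subrK subrK.
Qed.

Lemma casimir_comm k : casimir *m rho k = rho k *m casimir.
Proof. by apply: casimir_cocycle => j; rewrite -rhoP. Qed.

Lemma mxtrace_casimir : \tr casimir = r%:R.
Proof.
rewrite -[RHS]mxtrace1 -(mulVmx trace_form_unit) linear_sum;
  apply: eq_bigr => i _.
rewrite mxE linear_sum; apply: eq_bigr => j _ /=.
by rewrite linearZ /= !mxE.
Qed.

End Casimir.

Section Whitehead.
Variables (F : fieldType) (charF0 : [pchar F] =i pred0) (r : nat).
Variable A : 'I_r -> 'M[F]_r.
Hypotheses (perfA : mxperfect A) (irrA : mxirreducible A).

Lemma irreducible_cocycle_coboundary m n (rho : 'I_r -> 'M[F]_n.+1)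
    (D : 'I_r -> 'M[F]_(m, n.+1)) :
  mxirreducible rho -> mxrep A rho -> mxcocycle A rho D ->
  exists f, forall k, D k = f *m rho k.
Proof.
move=> irr rhoP DP; pose B : 'M[F]_r := \matrix_(i, j) \tr (rho i *m rho j).
have [B0|B0] := eqVneq B 0.
  have rho0 : forall k, rho k = 0.
    apply: (irreducible_trace_form0 charF0 perfA rhoP irr) => i j.
    by have := congr1 (fun M : 'M_r => M i j) B0; rewrite !mxE.
  exists 0 => k; rewrite mul0mx -(mxlin_delta D k).
  apply: (mxperfect_linear_eq0 perfA (f := mxlin D)).
    exact: mxlin_is_linear.
  by move=> i j; rewrite -DP !rho0 !mulmx0 subrr.
have cV := casimir_comm irrA rhoP B0; set c := casimir rho in cV.
have cu : c \in unitmx.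
  have [k|kc|fc] := irr (kermx c).
  - by apply/sub_kermxP; rewrite -mulmxA -cV mulmxA mulmx_ker mul0mx.
  - by rewrite -row_free_unit -kermx_eq0 kc.
  have c0 : c = 0 by rewrite -[c]mul1mx; apply/sub_kermxP; apply: submx_full.
  have := mxtrace_casimir irrA rhoP B0; rewrite -/c c0 linear0 => /esym/eqP.
  rewrite ((pcharf0P F).1 charF0) => /eqP r0.
  by case/eqP: B0; apply/matrixP => -[i ltir]; exfalso; rewrite r0 in ltir.
pose G := invmx B.
exists ((\sum_i \sum_j G i j *: (D j *m rho i)) *m invmx c) => k.
have -> : (\sum_i \sum_j G i j *: (D j *m rho i)) *m invmx c *m rho k =
    (\sum_i \sum_j G i j *: (D j *m rho i)) *m rho k *m invmx c.
  rewrite -!mulmxA; congr (_ *m _).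
  by apply: (canRL (mulmxK cu)); rewrite -mulmxA -cV mulKmx.
by rewrite (casimir_cocycle irrA rhoP B0 (E := D k)) ?mulmxK // => j;
  rewrite DP.
Qed.

Theorem whitehead_cocycle_coboundary m n (rho : 'I_r -> 'M[F]_n)
    (D : 'I_r -> 'M[F]_(m, n)) :
  mxrep A rho -> mxcocycle A rho D -> exists f, forall k, D k = f *m rho k.
Proof.
elim/ltn_ind: n => n IHn in rho D *; move=> rhoP DP.
case: n => [|n] in IHn rho D rhoP DP *.
  by exists 0 => k; rewrite mul0mx; apply: thinmx0.
have [irr|] := pselect (mxirreducible rho).
  exact: irreducible_cocycle_coboundary.
move=> /existsNP[U /not_implyP[rhoU /not_orP[U0 nfU]]].
have [C [C' [K [K' [CC' CK' KC' KK' [CK KU]]]]]] := adapted_basis U.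
have KrC k : K *m rho k *m C' = 0.
  have /submxP[W ->] : (K *m rho k <= K)%MS.
    by rewrite (eqmxMr _ KU) KU.
  by rewrite -mulmxA KC' mulmx0.
have mid p q (M : 'M_(p, n.+1)) (N : 'M_(n.+1, q)) :
    M *m N = M *m C' *m (C *m N) + M *m K' *m (K *m N).
  by rewrite -{1}[M]mulmx1 -CK mulmxDr mulmxDl !mulmxA.
pose sigma k := C *m rho k *m C'; pose tau k := K *m rho k *m K'.
have mxlinM p1 p2 q1 q2 (P : 'M_(p2, p1)) (Q : 'M_(q1, q2)) (T : 'I_r ->
  'M_(p1, q1)) x :
    mxlin (fun k => P *m T k *m Q) x = P *m mxlin T x *m Q.
  rewrite /mxlin mulmx_sumr mulmx_suml; apply: eq_bigr => k _.
  by rewrite -scalemxAr -scalemxAl.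
have sigmaM p (M : 'M_(p, n.+1)) k : M *m C' *m sigma k = M *m rho k *m C'.
  by rewrite -[RHS]mulmxA [RHS]mid (mulmxA K) KrC mulmx0 addr0 /sigma !mulmxA.
have tauM p (M : 'M_(p, n.+1)) k : M *m C' = 0 -> M *m K' *m tau k = M *m rho k
  *m K'.
  by move=> MC; rewrite -[RHS]mulmxA [RHS]mid MC mul0mx add0r /tau !mulmxA.
have sigmaP : mxrep A sigma.
  move=> i k; rewrite mxlinM -rhoP mulmxBr mulmxBl.
  by rewrite {1}/sigma {2}/sigma !sigmaM !mulmxA.
have tauP : mxrep A tau.
  move=> i k; rewrite mxlinM -rhoP mulmxBr mulmxBl.
  by rewrite {1}/tau {2}/tau !tauM ?KrC // !mulmxA.
have [||f' f'E] := IHn _ _ sigma (fun k => D k *m C') sigmaP.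
- by rewrite ltn_subrL lt0n mxrank_eq0 andbT; apply/eqP.
- move=> i k; rewrite !sigmaM -mulmxBl DP /mxlin mulmx_suml;
    apply: eq_bigr => l _.
  by rewrite -scalemxAl.
pose E k := D k - f' *m C *m rho k.
have EC k : E k *m C' = 0 by rewrite mulmxBl f'E /sigma !mulmxA subrr.
have EP : mxcocycle A rho E.
  move=> i k; have -> : mxlin E (row i (A k)) =
      mxlin D (row i (A k)) - f' *m C *m mxlin rho (row i (A k)).
    rewrite /mxlin mulmx_sumr -sumrB; apply: eq_bigr => l _.
    by rewrite -scalemxAr -scalerBr.
  rewrite -DP -rhoP !mulmxBl mulmxBr !mulmxA !opprB addrACA [RHS]addrACA.
  by congr (_ + _); apply: addrC.
have [||f'' f''E] := IHn _ _ tau (fun k => E k *m K') tauP.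
- by rewrite ltn_neqAle rank_leq_row andbT; apply/negP.
- move=> i k; rewrite !tauM // -mulmxBl EP /mxlin mulmx_suml;
    apply: eq_bigr => l _.
  by rewrite -scalemxAl.
exists (f' *m C + f'' *m K) => k.
have fK : f'' *m K *m rho k = E k.
  have h1 : f'' *m K *m rho k *m C' = 0 by rewrite -!mulmxA (mulmxA K) KrC
    mulmx0.
  have h2 : f'' *m K *m rho k *m K' = E k *m K' by rewrite f''E /tau !mulmxA.
  by rewrite -[LHS]mulmx1 -[RHS]mulmx1 -CK !mulmxDr !mulmxA h1 h2 EC.
by rewrite mulmxDl fK addrC subrK.
Qed.
End Whitehead.

(** * Subspaces and coordinates *)

Section Subspaces.
Variables (F : fieldType) (V : lmodType F).
Implicit Types A B : set V.

Lemma subspaceP A :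
  subspace A <-> A 0 /\ (forall a u v, A u -> A v -> A (a *: u + v)).
Proof.
split=> [[A0 AZ]|[A0 AZ]].
  split=> [|a u v Au Av]; first exact: set_mem A0.
  by apply/set_mem/AZ; apply: mem_set.
by split=> [|a u v /set_mem Au /set_mem Av]; apply: mem_set; [|apply: AZ].
Qed.

Lemma subspace0 A : subspace A -> A 0.
Proof. by case/subspaceP. Qed.

Lemma subspaceD A u v : subspace A -> A u -> A v -> A (u + v).
Proof. by case/subspaceP=> _ AZ Au Av; rewrite -[u]scale1r; apply: AZ. Qed.

Lemma subspaceZ A a u : subspace A -> A u -> A (a *: u).
Proof. by case/subspaceP=> A0 AZ Au; rewrite -[_ *: _]addr0; apply: AZ. Qed.

Lemma subspaceB A u v : subspace A -> A u -> A v -> A (u - v).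
Proof.
by move=> sA Au Av; rewrite -scaleN1r; apply: subspaceD => //; apply: subspaceZ.
Qed.

Lemma subspace_sum A I (s : seq I) (P : pred I) (f : I -> V) :
  subspace A -> (forall i, P i -> A (f i)) -> A (\sum_(i <- s | P i) f i).
Proof.
move=> sA Af; apply: (big_ind A) => //; first exact: subspace0.
by move=> u v; apply: subspaceD.
Qed.

Lemma linspan_subspace A : subspace (linspan A).
Proof.
apply/subspaceP; split=> [B [sB _]|a u v Au Av B [sB AB]];
  first exact: subspace0.
by apply: subspaceD; [|apply: subspaceZ; [|apply: Au]|apply: Av].
Qed.

Lemma linspan_gen A x : A x -> linspan A x.
Proof. by move=> Ax B [_ AB]; apply: AB. Qed.

Lemma linspan_sub A B : subspace B -> A `<=` B -> linspan A `<=` B.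
Proof. by move=> sB AB x; apply. Qed.

Lemma subspaceT : subspace [set: V].
Proof. by apply/subspaceP. Qed.

Lemma range_subspace (W : lmodType F) (f : {linear W -> V}) :
  subspace (range f).
Proof.
apply/subspaceP; split=> [|a _ _ [u _ <-] [v _ <-]].
  by exists 0; rewrite ?linear0.
by exists (a *: u + v); rewrite ?linearP.
Qed.

Lemma row_span_is_linear n (s : 'I_n -> V) :
  linear (fun x : 'rV[F]_n => \sum_i x 0 i *: s i).
Proof.
move=> a x y; rewrite scaler_sumr -big_split; apply: eq_bigr => i _.
by rewrite !mxE scalerDl scalerA.
Qed.

Lemma range_finite_dim n (f : {linear 'rV[F]_n -> V}) : finite_dim (range f).
Proof.
exists [seq f (delta_mx 0 i) | i <- enum 'I_n].
apply/seteqP; split; last first.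
  apply: linspan_sub; first exact: range_subspace.
  by move=> _ /= /mapP[i _ ->]; exists (delta_mx 0 i).
move=> _ [x _ <-]; rewrite (row_sum_delta x) linear_sum.
apply: subspace_sum; first exact: linspan_subspace.
move=> i _; rewrite linearZ; apply: (@subspaceZ (linspan _)).
  exact: linspan_subspace.
by apply: linspan_gen => /=; apply: map_f; rewrite mem_enum.
Qed.

Lemma linear_injective_part n (f : {linear 'rV[F]_n -> V}) :
  exists m (g : {linear 'rV[F]_m -> V}), injective g /\ range g = range f.
Proof.
have [||U UP] := @subspace_mx _ n (fun v => f v = 0); first exact: linear0.
  by move=> a u v fu fv; rewrite linearP fu fv scaler0 addr0.
have [C [C' [K [K' [CC' CK' KC' KK' [CK KU]]]]]] := adapted_basis U.
have lg : linear (fun v => f (v *m C)).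
  by move=> a u v; rewrite mulmxDl -scalemxAl linearP.
exists _, (linear_pack lg); split.
  move=> u v /eqP; rewrite -subr_eq0 -linearB => /eqP/UP.
  rewrite -KU => /submxP[w /(congr1 (mulmx^~ C'))].
  by rewrite /= -!mulmxA CC' KC' mulmx1 mulmx0 => /eqP;
    rewrite subr_eq0 => /eqP.
apply/seteqP; split=> _ [u _ <-]; first by exists (u *m C).
exists (u *m C') => //;
  rewrite /linear_pack -[in RHS](mulmx1 u) -CK mulmxDr !mulmxA.
rewrite linearD (_ : f (u *m K' *m K) = 0) ?addr0 //.
by apply/UP; rewrite -KU submxMl.
Qed.

Lemma finite_dim_parametrization A : finite_dim A ->
  exists n (f : {linear 'rV[F]_n -> V}), injective f /\ range f = A.
Proof.
move=> [s ->].
pose f : {linear 'rV[F]_(size s) -> V} :=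
  linear_pack (row_span_is_linear (fun i : 'I_(size s) => s`_i)).
have [n [g [ginj gf]]] := linear_injective_part f.
exists n, g; split=> //; rewrite {}gf; apply/seteqP; split.
  move=> _ [x _ <-]; apply: subspace_sum; first exact: linspan_subspace.
  move=> i _; apply: (@subspaceZ (linspan _)); first exact: linspan_subspace.
  by apply: linspan_gen => /=; apply: mem_nth.
apply: linspan_sub; first exact: range_subspace.
move=> x /= /(nthP 0)[i ltis <-]; exists (delta_mx 0 (Ordinal ltis)) => //.
rewrite /f /linear_pack (bigD1 (Ordinal ltis)) //= big1 ?addr0 => [|j ji].
  by rewrite mxE !eqxx scale1r.
by rewrite mxE (negPf ji) andbF scale0r.
Qed.

Lemma linear_inverse (W : lmodType F) (f : {linear W -> V}) :
  injective f -> range f = [set: V] ->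
  exists g : {linear V -> W}, cancel f g /\ cancel g f.
Proof.
move=> finj fT.
have /choice[g gK] : forall y, exists x, f x = y.
  move=> y; have [x _ <-] : range f y by rewrite fT.
  by exists x.
have lg : linear g by move=> a u v; apply: finj; rewrite linearP !gK.
exists (linear_pack lg); split=> // x; apply: finj; rewrite /linear_pack gK //.
Qed.

Lemma adapted_coordinates A : subspace A -> finite_dim [set: V] ->
  exists r q (i : {linear 'rV[F]_r -> V}) (j : {linear 'rV[F]_q -> V})
         (p : {linear V -> 'rV[F]_r}) (t : {linear V -> 'rV[F]_q}),
    [/\ cancel i p, cancel j t, forall u, t (i u) = 0 &
       (forall x, x = i (p x) + j (t x)) /\ (forall x, A x <-> p x = 0)].
Proof.
move=> sA /finite_dim_parametrization[n [f [finj fT]]].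
have [g [fK gK]] := linear_inverse finj fT.
have [||U UP] := @subspace_mx _ n (fun v => A (f v)).
- by rewrite linear0; apply: subspace0.
- by move=> a u v Au Av; rewrite linearP; case/subspaceP: sA => _; apply.
have [C [C' [K [K' [CC' CK' KC' KK' [CK KU]]]]]] := adapted_basis U.
have li : linear (fun v => f (v *m C)).
  by move=> a u v; rewrite mulmxDl -scalemxAl linearP.
have lj : linear (fun v => f (v *m K)).
  by move=> a u v; rewrite mulmxDl -scalemxAl linearP.
have lp : linear (fun x => g x *m C').
  by move=> a u v; rewrite linearP mulmxDl -scalemxAl.
have lt : linear (fun x => g x *m K').
  by move=> a u v; rewrite linearP mulmxDl -scalemxAl.
exists _, _, (linear_pack li), (linear_pack lj), (linear_pack lp), (linear_pack
  lt).
split=> [u|u|u|]; rewrite /= /linear_pack.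
- by rewrite fK -mulmxA CC' mulmx1.
- by rewrite fK -mulmxA KK' mulmx1.
- by rewrite fK -mulmxA CK' mulmx0.
split=> x; first by rewrite -linearD -!mulmxA -mulmxDr CK mulmx1 gK.
rewrite -[in A x](gK x) -UP -KU; split=> [/submxP[w ->]|gC].
  by rewrite -mulmxA KC' mulmx0.
by rewrite -[g x]mulmx1 -CK mulmxDr mulmxA gC mul0mx add0r mulmxA submxMl.
Qed.

End Subspaces.

(** * Leibniz algebras *)

Section Leibniz.
Variables (F : fieldType) (L : lmodType F) (mul : {bilinear L -> L -> L}).
Hypothesis mulL : left_leibniz mul.
Local Notation K := (Leib mul).

Lemma Leib_subspace : subspace K.
Proof. exact: linspan_subspace. Qed.

Lemma Leib_sqr x : K (mul x x).
Proof. by apply: linspan_gen; exists x. Qed.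

Lemma Leib_addC x y : K (mul x y + mul y x).
Proof.
have -> : mul x y + mul y x = mul (x + y) (x + y) - mul x x - mul y y.
  rewrite linearDl !linearDr [mul x x + _]addrC addrACA.
  by rewrite -[RHS]addrA -opprD addrK.
apply: subspaceB Leib_subspace _ (Leib_sqr _).
exact: subspaceB Leib_subspace (Leib_sqr _) (Leib_sqr _).
Qed.

Lemma Leib_mull x y : K x -> mul x y = 0.
Proof.
pose Z : set L := [set x | forall y, mul x y = 0].
suff KZ : K `<=` Z by move=> /KZ.
apply: linspan_sub.
  apply/subspaceP; split=> [z|a u v Zu Zv z]; first by rewrite linear0l.
  by rewrite linearPl Zu Zv scaler0 addr0.
by move=> _ [u _ <-] z; apply: (addIr (mul u (mul u z))); rewrite -mulL add0r.
Qed.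

Lemma Leib_mulr x y : K y -> K (mul x y).
Proof.
pose Z : set L := [set y | K (mul x y)].
suff KZ : K `<=` Z by move=> /KZ.
apply: linspan_sub.
  apply/subspaceP; split=> [|a u v Zu Zv]; rewrite /Z /=.
    by rewrite linear0r; apply: subspace0 Leib_subspace.
  by rewrite linearPr; case/subspaceP: Leib_subspace => _; apply.
by move=> _ [u _ <-]; rewrite /Z /= mulL; apply: Leib_addC.
Qed.

Lemma left_ideal_ideal (I : set L) : subspace I -> K `<=` I ->
  (forall x y, I y -> I (mul x y)) -> ideal mul [set: L] I.
Proof.
move=> sI KI lI; split=> // x y _ Iy; split; first exact: lI.
rewrite -[mul y x](addrK (mul x y)); apply: subspaceB => //; last exact: lI.
by apply: KI; apply: Leib_addC.
Qed.

Lemma Leib_submodule_ideal (I : set L) : subspace I -> I `<=` K ->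
  (forall x y, I y -> I (mul x y)) -> ideal mul [set: L] I.
Proof.
move=> sI IK lI; split=> // x y _ Iy; split; first exact: lI.
by rewrite Leib_mull; [apply: subspace0 | apply: IK].
Qed.

Lemma derived_mul x y : derived mul (mul x y).
Proof. by apply: linspan_gen; exists x => //; exists y. Qed.

Lemma derived_ideal : ideal mul [set: L] (derived mul).
Proof.
apply: left_ideal_ideal; first exact: linspan_subspace.
  apply: linspan_sub; first exact: linspan_subspace.
  by move=> _ [x _ <-]; apply: derived_mul.
by move=> x y _; apply: derived_mul.
Qed.

End Leibniz.

Lemma subrBB (V : zmodType) (a b c d : V) : a - b - (c - d) = a + d - (b + c).
Proof. by rewrite opprB addrACA -opprD. Qed.

Lemma mulmx_row_inj (R : pzSemiRingType) m n (M N : 'M[R]_(m, n)) :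
  (forall u : 'rV_m, u *m M = u *m N) -> M = N.
Proof. by move=> MN; apply/row_matrixP => i; rewrite !rowE. Qed.

Lemma lin1_mxE (F : fieldType) m n (f : 'rV[F]_m -> 'rV[F]_n) u :
  linear f -> u *m lin1_mx f = f u.
Proof. by move=> lf; rewrite (mul_rV_lin1 (linear_pack lf)). Qed.

Section Levi.
Variables (F : fieldType) (charF0 : [pchar F] =i pred0).
Variables (L : lmodType F) (mul : {bilinear L -> L -> L}).
Hypothesis mulL : left_leibniz mul.
Local Notation K := (Leib mul).
Hypotheses (fdL : finite_dim [set: L]) (simL : simple_leibniz mul).

Lemma derivedT : derived mul = [set: L].
Proof.
have [idL [KD nDK]] := simL.
have [D0|DK|//] := idL _ (derived_ideal mul).
- case: nDK; rewrite D0 => _ ->; exact: subspace0 (Leib_subspace mul).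
- by case: nDK; rewrite DK.
Qed.

Lemma levi_complement :
  exists r (s : {linear 'rV[F]_r -> L}) (p : {linear L -> 'rV[F]_r}),
    [/\ cancel s p, forall x, K x <-> p x = 0
      & forall x v, exists w, mul x (s v) = s w].
Proof.
have [r [q [i [j [p [t [pi tj ti [xE Kp]]]]]]]] :=
  adapted_coordinates (Leib_subspace mul) fdL.
have pj w : p (j w) = 0.
  have := congr1 p (xE (j w)); rewrite linearD pi tj => /eqP.
  by rewrite addrC -subr_eq subrr eq_sym => /eqP.
have Kj w : K (j w) by apply/Kp.
have jK x : K x -> x = j (t x).
  by move=> /Kp px; rewrite {1}[x]xE px linear0 add0r.
pose e (k : 'I_r) := i (delta_mx 0 k).
have lpi k : linear (fun v => p (mul (e k) (i v))).
  by move=> a u v; rewrite linearP linearPr linearP.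
have ltj k : linear (fun w => t (mul (e k) (j w))).
  by move=> a u v; rewrite linearP linearPr linearP.
have lti k : linear (fun v => t (mul (e k) (i v))).
  by move=> a u v; rewrite linearP linearPr linearP.
pose A k := lin1_mx (fun v => p (mul (e k) (i v))).
pose rho k := lin1_mx (fun w => t (mul (e k) (j w))).
pose D k := lin1_mx (fun v => t (mul (e k) (i v))).
have mul_p x y : mul x y = mul (i (p x)) y.
  by rewrite {1}[x]xE linearDl [mul (j _) _]Leib_mull ?addr0.
have mulE x y : mul x y = \sum_k p x 0 k *: mul (e k) y.
  rewrite mul_p {1}[p x]row_sum_delta linear_sum linear_sumlz.
  by apply: eq_bigr => k _; rewrite linearZ linearZl_LR.
have mulA x v : p (mul x (i v)) = v *m mxlin A (p x).
  rewrite mulE linear_sum /mxlin mulmx_sumr; apply: eq_bigr => k _.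
  by rewrite linearZ -scalemxAr lin1_mxE.
have mulD x v : t (mul x (i v)) = v *m mxlin D (p x).
  rewrite mulE linear_sum /mxlin mulmx_sumr; apply: eq_bigr => k _.
  by rewrite linearZ -scalemxAr lin1_mxE.
have mulR x w : mul x (j w) = j (w *m mxlin rho (p x)).
  rewrite [LHS]jK; last exact: Leib_mulr.
  congr (j _); rewrite mulE linear_sum /mxlin mulmx_sumr; apply: eq_bigr => k _.
  by rewrite linearZ -scalemxAr lin1_mxE.
have pmul x y : p (mul x y) = p y *m mxlin A (p x).
  rewrite -mulA {1}[y]xE linearDr linearD.
  by rewrite [p (mul x (j _))](Kp _).1 ?addr0 //; apply: Leib_mulr.
have tmul x y : t (mul x y) = p y *m mxlin D (p x) + t y *m mxlin rho (p x).
  by rewrite {1}[y]xE linearDr linearD mulD mulR tj.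
have irrA : mxirreducible A.
  move=> U stU; have stU' u : (U *m mxlin A u <= U)%MS.
    rewrite /mxlin mulmx_sumr summx_sub // => k _.
    by rewrite -scalemxAr scalemx_sub.
  pose I : set L := [set x | (p x <= U)%MS].
  have sI : subspace I.
    apply/subspaceP; split=> [|a x y Ix Iy]; rewrite /I /= ?linear0 ?sub0mx //.
    by rewrite linearP addmx_sub ?scalemx_sub.
  have /(simL.1)[I0|IK|IT] : ideal mul [set: L] I.
  - apply: left_ideal_ideal => // [x /Kp|x y Iy]; rewrite /I /=.
      by move->; rewrite sub0mx.
    by rewrite pmul (submx_trans _ (stU' (p x))) // submxMr.
  - left; apply/row_matrixP => l; rewrite row0 -[row l U]pi.
    have : I (i (row l U)) by rewrite /I /= pi row_sub.
    by rewrite I0 => ->; rewrite linear0.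
  - left; apply/row_matrixP => l; rewrite row0 -[row l U]pi.
    have : I (i (row l U)) by rewrite /I /= pi row_sub.
    by rewrite IK => /Kp.
  - right; rewrite -sub1mx; apply/row_subP => l.
    have : I (i (row l 1%:M)) by rewrite IT.
    by rewrite /I /= pi.
have perfA : mxperfect A.
  pose I : set L := [set x | (p x <= \sum_k A k)%MS].
  have DI : derived mul `<=` I.
    apply: linspan_sub.
      apply/subspaceP; split=> [|a x y Ix Iy];
        rewrite /I /= ?linear0 ?sub0mx //.
      by rewrite linearP addmx_sub ?scalemx_sub.
    move=> _ [x _ [y _ <-]];
      rewrite /I /= pmul /mxlin mulmx_sumr summx_sub // => k _.
    by rewrite -scalemxAr scalemx_sub // (submx_trans (submxMl _ _)) //
      (sumsmx_sup k).
  have : (1%:M <= \sum_k A k)%MS.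
    apply/row_subP => l; rewrite -[row l _]pi; apply: DI.
    by rewrite derivedT.
  by case/sub_sumsmxP => W W1; exists W.
have AP u v : mxlin A v *m mxlin A u - mxlin A u *m mxlin A v
    = mxlin A (v *m mxlin A u).
  apply: mulmx_row_inj => w; have := congr1 p (mulL (i u) (i v) (i w)).
  rewrite linearD !pmul !pi mulmxBr !mulmxA => ->.
  by rewrite addrK.
have rhoP u v : mxlin rho v *m mxlin rho u - mxlin rho u *m mxlin rho v
    = mxlin rho (v *m mxlin A u).
  apply: mulmx_row_inj => w; have := congr1 t (mulL (i u) (i v) (j w)).
  rewrite linearD !tmul !pmul !pi !pj tj !mul0mx !add0r mulmxBr !mulmxA => ->.
  by rewrite addrK.
have DP u v : mxlin D (v *m mxlin A u) = mxlin A v *m mxlin D u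
    + mxlin D v *m mxlin rho u
    - (mxlin A u *m mxlin D v + mxlin D u *m mxlin rho v).
  apply: mulmx_row_inj => w; have := congr1 t (mulL (i u) (i v) (i w)).
  rewrite linearD !tmul !pmul !pi !ti !mul0mx !addr0 mulmxBr !mulmxDr !mulmxA
    => ->.
  by rewrite addrK.
pose rhoN k := lin_mx (mulmxr (rho k)) - lin_mx (mulmx (A k)) : 'M[F]_(r * q).
have rhoNE k (f : 'M_(r, q)) : mxvec f *m rhoN k = mxvec (f *m rho k - A k *m
  f).
  by rewrite mulmxBr !mul_vec_lin linearB.
have rhoNlin u (f : 'M_(r, q)) : mxvec f *m mxlin rhoN u =
    mxvec (f *m mxlin rho u - mxlin A u *m f).
  rewrite /mxlin mulmx_sumr mulmx_sumr mulmx_suml -sumrB linear_sum.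
  apply: eq_bigr => k _.
  by rewrite -!scalemxAr rhoNE -scalemxAl -scalerBr linearZ.
have rhoNP : mxrep A rhoN.
  move=> k l; apply: mulmx_row_inj => w; rewrite -(vec_mxK w);
    move: (vec_mx w) => f.
  rewrite mulmxBr !mulmxA !rhoNE -linearB rhoNlin /=; congr mxvec.
  have -> : row k (A l) = delta_mx 0 k *m mxlin A (delta_mx 0 l).
    by rewrite mxlin_delta -rowE.
  rewrite -rhoP -AP !mxlin_delta !(mulmxBr, mulmxBl) !mulmxA.
  rewrite [LHS]subrBB [X in X - _ = _]addrA subrK.
  rewrite [X in _ - X = _]addrC [X in _ - X = _]addrA subrK !subrBB.
  by congr (_ - _); apply: addrC.
have DNP : mxcocycle A rhoN (fun k => mxvec (D k)).
  move=> k l; rewrite !rhoNE -linearB /= subrBB.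
  transitivity (mxvec (mxlin D (row k (A l)))); last first.
    by rewrite linear_sum; apply: eq_bigr => m _; rewrite linearZ.
  have -> : row k (A l) = delta_mx 0 k *m mxlin A (delta_mx 0 l).
    by rewrite mxlin_delta -rowE.
  by rewrite DP !mxlin_delta [A k *m _ + _]addrC.
have [f0 f0E] := whitehead_cocycle_coboundary charF0 perfA irrA rhoNP DNP.
pose f := vec_mx f0.
(* Correcting the linear section [i] by [f] makes it a module map. *)
have fE k : D k = f *m rho k - A k *m f.
  by apply: (can_inj mxvecK); rewrite f0E -rhoNE vec_mxK.
have fElin u : mxlin D u = f *m mxlin rho u - mxlin A u *m f.
  rewrite /mxlin mulmx_sumr mulmx_suml -sumrB; apply: eq_bigr => k _.
  by rewrite fE -scalemxAr -scalemxAl -scalerBr.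
have ls : linear (fun u => i u - j (u *m f)).
  move=> a u v; rewrite mulmxDl -scalemxAl !linearP.
  by rewrite addrACA -scalerDr.
exists r, (linear_pack ls), p; split=> // [u|x v].
  by rewrite /= /linear_pack linearB pi pj subr0.
exists (v *m mxlin A (p x)); rewrite /= /linear_pack.
rewrite linearBr mulR [mul x (i v)]xE mulA mulD fElin mulmxBr linearB !mulmxA.
by rewrite -addrA addrAC subrr sub0r.
Qed.
End Levi.

Lemma set0_eq (V : zmodType) (A : set V) : A 0 -> (forall x, A x -> x = 0) ->
  A = [set 0].
Proof. by move=> A0 A1; apply/seteqP; split=> [x /A1|_ ->]. Qed.

Lemma simple_leibniz_decomposition (F : fieldType) (charF0 : [pchar F] =i pred0)
    (L : lmodType F) (mul : {bilinear L -> L -> L}) (mulL : left_leibniz mul) :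
  finite_dim [set: L] -> simple_leibniz mul ->
  exists g : set L,
    [/\ finite_dim g, simple_lie mul g, direct_sum g (Leib mul)
      & Leib mul = [set 0] \/
        [/\ finite_dim (Leib mul),
            irreducible_bimodule mul g (Leib mul) mul mul,
            antisymmetric_bimodule g (Leib mul) mul
          & ~ trivial_bimodule g (Leib mul) mul mul]].
Proof.
move=> fdL simL; have [idL [KD nDK]] := simL.
have [r [s [p [sK Kp mulS]]]] := levi_complement charF0 mulL fdL simL.
pose K := Leib mul; pose g := range s.
have sK' : subspace K by apply: Leib_subspace.
have sg : subspace g by apply: range_subspace.
have gs v : g (s v) by exists v.
have lg x y : g y -> g (mul x y).
  by move=> [v _ <-]; have [w ->] := mulS x v.
have gK x : g x -> K x -> x = 0.
  by move=> [v _ <-] /Kp; rewrite sK => ->; rewrite linear0.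
have spK x : K (x - s (p x)) by apply/Kp; rewrite linearB sK subrr.
have spg x : g x -> s (p x) = x by move=> [v _ <-]; rewrite sK.
have mulK0 x y : K x -> mul x y = 0 by apply: Leib_mull.
have mulK x y : K y -> K (mul x y) by apply: Leib_mulr.
have mulsp x y : mul x y = mul (s (p x)) y.
  by rewrite -[x in LHS](subrK (s (p x))) linearDl mulK0 ?add0r.
have anti x y : g x -> g y -> mul x y = - mul y x.
  move=> gx gy; apply/eqP; rewrite -addr_eq0; apply/eqP/gK;
    last exact: Leib_addC.
  by apply: subspaceD => //; apply: lg.
have gg x : g x -> mul x x = 0.
  by move=> gx; apply: gK; [apply: lg | apply: Leib_sqr].
exists g; split.
- exact: range_finite_dim.
- split; first split => //.
  + by split=> // x y _; apply: lg.
  + move=> x y z gx gy gz; rewrite mulL (anti z (mul x y)) ?(anti z x) //;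
      last exact: lg.
    by rewrite linearNr addrK subrr.
  + apply: contrapT => abel; apply: nDK;
      apply: linspan_sub => // _ [x _ [y _ <-]].
    rewrite mulsp -[y](subrK (s (p y))) linearDr addrC.
    rewrite (_ : mul _ (s _) = 0) ?add0r; first exact: mulK.
    by apply: contrapT => ne0; apply: abel; exists (s (p x)), (s (p y)).
  + move=> I [sI Ig II]; pose J : set L := [set x | I (s (p x))].
    have sJ : subspace J.
      apply/subspaceP; split=> [|a x y Ix Iy]; rewrite /J /= ?linear0;
        first exact: subspace0.
      by rewrite !linearP; case/subspaceP: sI => _; apply.
    have IJ x : I x -> J x by move=> Ix; rewrite /J /= spg //; apply: Ig.
    have /idL[J0|JK|JT] : ideal mul [set: L] J.
    * apply: left_ideal_ideal => // [x /Kp|x y Jy]; rewrite /J /=.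
        by move=> ->; rewrite linear0; apply: subspace0.
      rewrite mulsp -[y](subrK (s (p y))) linearDr linearD.
      rewrite (Kp _).1 ?add0r; last exact: mulK.
      by rewrite spg; [have [] := II _ _ (gs (p x)) Jy | apply: lg].
    * by left; apply: set0_eq => [|x /IJ]; [apply: subspace0 | rewrite J0].
    * left; apply: set0_eq => [|x Ix]; first exact: subspace0.
      by apply: gK; [apply: Ig | rewrite /K -JK; apply: IJ].
    * right; apply/seteqP; split=> // x gx; rewrite -(spg _ gx).
      by have : J x by rewrite JT.
- split=> //.
    apply/seteqP; split=> [x [gx Kx]|_ ->]; first exact: gK.
    by split; apply: subspace0.
  move=> x; exists (s (p x)), (x - s (p x)); split=> //; first exact: spK.
  by rewrite addrC subrK.
- have [K0|K0] := pselect (K = [set 0]); [by left | right; split].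
  + have [n [f [_ fT]]] := finite_dim_parametrization fdL.
    have lf : linear (fun v => f v - s (p (f v))).
      by move=> a u v; rewrite !linearP addrACA -scalerDr.
    rewrite -/K (_ : K = range (linear_pack lf)); first exact: range_finite_dim.
    apply/seteqP; split=> [x Kx|_ [v _ <-]]; last exact: spK.
    have [v _ vx] : range f x by rewrite fT.
    by exists v => //; rewrite /= /linear_pack vx (Kp x).1 // linear0 subr0.
  + split=> //; first split=> //.
    * by move=> x m gx Km; split; [apply: mulK | rewrite mulK0 //;
        apply: subspace0].
    * move=> x y m gx gy Km; split; first by rewrite mulL addrK.
        by rewrite [mul x (mul m y)]mulL addrK.
      by rewrite [mul m (mul x y)]mulL addrK.
    * move=> U sU UK stU.
      have /idL[->|->|UT] : ideal mul [set: L] U.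
      - apply: Leib_submodule_ideal => // x y Uy.
        by rewrite mulsp; have [] := stU _ _ (gs (p x)) Uy.
      - by left.
      - by right.
      - by right; apply/seteqP; split=> // x _; rewrite UT.
  + by move=> x m _ /mulK0.
  + move=> triv; apply: K0; apply: set0_eq => [|x]; first exact: subspace0.
    move: x; apply: linspan_sub.
      apply/subspaceP; split=> // a u v -> ->; by rewrite scaler0 addr0.
    move=> _ [x _ <-];
      rewrite mulsp -[x in mul _ x](subrK (s (p x))) linearDr gg // addr0.
    by have [] := triv _ _ (gs (p x)) (spK x).
Qed.

Definition bilinear_pack (F : fieldType) (U V W : lmodType F) (f : U -> V -> W)
  (_ : bilinear_for *:%R *:%R f) : U -> V -> W := f.

HB.instance Definition _ (F : fieldType) (U V W : lmodType F) (f : U -> V -> W)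
    (bf : bilinear_for *:%R *:%R f) :=
  bilinear_isBilinear.Build F U V W *:%R *:%R (bilinear_pack bf) bf.

Lemma decomposition_hemi_semidirect (F : fieldType)
    (L : lmodType F) (mul : {bilinear L -> L -> L}) (mulL : left_leibniz mul)
    (g : set L) :
  finite_dim g -> simple_lie mul g -> direct_sum g (Leib mul) ->
  Leib mul = [set 0] \/
    [/\ finite_dim (Leib mul),
        irreducible_bimodule mul g (Leib mul) mul mul,
        antisymmetric_bimodule g (Leib mul) mul
      & ~ trivial_bimodule g (Leib mul) mul mul] ->
  (finite_dim [set: L] /\ simple_lie mul [set: L]) \/
  exists (g M : lmodType F)
         (br : {bilinear g -> g -> g}) (act : {bilinear g -> M -> M}),
    [/\ finite_dim [set: g] /\ simple_lie br [set: g],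
        finite_dim [set: M] /\ irreducible_left_module br act,
        ~ trivial_left_module act
      & algebra_iso mul (hemi_semidirect br act)].
Proof.
move=> fdg simg [sg sK gK gDK] [K0|[fdK [[_ stK bimK] K0 irrK] asK ntK]].
  left; suff gT : g = [set: L] by rewrite -gT.
  apply/seteqP; split=> // x _; have [a [b [ga + ->]]] := gDK x.
  by rewrite K0 => ->; rewrite addr0.
right; have [r [phi [phi_inj phi_g]]] := finite_dim_parametrization fdg.
have [q [psi [psi_inj psi_K]]] := finite_dim_parametrization fdK.
have gphi u : g (phi u) by rewrite -phi_g; exists u.
have Kpsi w : Leib mul (psi w) by rewrite -psi_K; exists w.
have ltheta : linear (fun x : 'rV[F]_r * 'rV[F]_q => phi x.1 + psi x.2).
  by move=> a x y; rewrite !linearP /= scalerDr addrACA.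
pose theta : {linear ('rV[F]_r * 'rV[F]_q)%type -> L} := linear_pack ltheta.
have [||f [thetaK fK]] := @linear_inverse _ _ _ theta.
- move=> [u w] [u' w'] /eqP; rewrite -subr_eq0 -linearB => /eqP.
  rewrite /theta /linear_pack /= => /eqP; rewrite addr_eq0 => /eqP E.
  have : (g `&` Leib mul) (phi (u - u')).
    split=> //; rewrite E -linearN; exact: Kpsi.
  rewrite gK => p0; have u0 : u - u' = 0 by apply: phi_inj; rewrite linear0.
  move: E; rewrite p0 => /esym/eqP; rewrite oppr_eq0 => /eqP q0.
  have w0 : w - w' = 0 by apply: psi_inj; rewrite linear0.
  by rewrite -[u](subrK u') u0 add0r -[w](subrK w') w0 add0r.
- apply/seteqP; split=> // x _; have [a [b [+ + ->]]] := gDK x.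
  by rewrite -phi_g -psi_K => -[u _ <-] [w _ <-]; exists (u, w).
have thetaE u w : theta (u, w) = phi u + psi w by [].
have fphi u : f (phi u) = (u, 0) by rewrite -[RHS]thetaK thetaE linear0 addr0.
have fpsi w : f (psi w) = (0, w) by rewrite -[RHS]thetaK thetaE linear0 add0r.
have bbr : bilinear_for *:%R *:%R (fun u v => (f (mul (phi u) (phi v))).1).
  split=> [w a u v|w a u v]; first by rewrite !linearP linearPl linearP.
  by rewrite !linearP.
have bact : bilinear_for *:%R *:%R (fun u w => (f (mul (phi u) (psi w))).2).
  split=> [w a u v|w a u v]; first by rewrite !linearP linearPl linearP.
  by rewrite !linearP.
pose br : {bilinear 'rV[F]_r -> 'rV[F]_r -> 'rV[F]_r} := bilinear_pack bbr.
pose act : {bilinear 'rV[F]_r -> 'rV[F]_q -> 'rV[F]_q} := bilinear_pack bact.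
have [[[_ gM] gxx gJ] [x [y [gx gy xy0]]] gI] := simg.
have brD u v : br u v = (f (mul (phi u) (phi v))).1 by [].
have actD u w : act u w = (f (mul (phi u) (psi w))).2 by [].
have brE u v : phi (br u v) = mul (phi u) (phi v).
  have : g (mul (phi u) (phi v)) by apply: gM.
  by rewrite -phi_g => -[w _ wE]; rewrite brD -wE fphi.
have actE u w : psi (act u w) = mul (phi u) (psi w).
  have [+ _] := stK _ _ (gphi u) (Kpsi w).
  by rewrite -psi_K => -[z _ zE]; rewrite actD -zE fpsi.
have range_id n : range (idfun : 'rV[F]_n -> 'rV[F]_n) = setT.
  by apply/seteqP; split=> // u _; exists u.
exists 'rV[F]_r, 'rV[F]_q, br, act; split.
- split; first by rewrite -range_id; apply: range_finite_dim.
  split.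
  + split; first by split=> //; apply: subspaceT.
      by move=> u _; apply: phi_inj; rewrite brE gxx ?linear0.
    move=> u v w _ _ _; apply: phi_inj.
    by rewrite !linearD !brE gJ ?linear0.
  + move: gx gy xy0; rewrite -phi_g => -[u _ <-] [v _ <-] uv0.
    by exists u, v; split=> // uv; apply: uv0; rewrite -brE uv linear0.
  + move=> I [sI _ II].
    have [I0|Ig] : phi @` I = [set 0] \/ phi @` I = g.
    * apply: gI; split.
      - apply/subspaceP; split=> [|a _ _ [u Iu <-] [v Iv <-]].
          by exists 0; [apply: subspace0 | rewrite linear0].
        exists (a *: u + v); last by rewrite linearP.
        by case/subspaceP: sI => _; apply.
      - by move=> _ [u _ <-].
      - rewrite -phi_g => _ _ [u _ <-] [v Iv <-].
        by have [uv vu] := II u v Logic.I Iv; split;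
          [exists (br u v)|exists (br v u)].
    * left; apply: set0_eq => [|u Iu]; first exact: subspace0.
      apply: phi_inj; rewrite linear0.
      by have : (phi @` I) (phi u) by [exists u]; rewrite I0.
    * right; apply/seteqP; split=> // u _.
      have : (phi @` I) (phi u) by rewrite Ig.
      by move=> [v Iv /phi_inj <-].
- split; first by rewrite -range_id; apply: range_finite_dim.
  split.
  + move=> u v w; apply: psi_inj; rewrite linearB !actE brE.
    by have [-> _ _] := bimK _ _ _ (gphi u) (gphi v) (Kpsi w).
  + move=> T0; apply: K0; apply: set0_eq => [|z]; first exact: subspace0.
    rewrite -psi_K => -[w _ <-]; have : [set: 'rV[F]_q] w by [].
    by rewrite T0 => ->; rewrite linear0.
  + move=> U sU stU.
    have [U0|UK] : psi @` U = [set 0] \/ psi @` U = Leib mul.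
    * apply: irrK.
      - apply/subspaceP; split=> [|a _ _ [u Uu <-] [v Uv <-]].
          by exists 0; [apply: subspace0 | rewrite linear0].
        exists (a *: u + v); last by rewrite linearP.
        by case/subspaceP: sU => _; apply.
      - by move=> _ [w _ <-].
      - rewrite -phi_g => _ _ [u _ <-] [w Uw <-]; split.
          by exists (act u w) => //; apply: stU.
        by rewrite asK //; exists 0; [apply: subspace0 | rewrite linear0].
    * left; apply: set0_eq => [|u Uu]; first exact: subspace0.
      apply: psi_inj; rewrite linear0.
      by have : (psi @` U) (psi u) by [exists u]; rewrite U0.
    * right; apply/seteqP; split=> // w _.
      have : (psi @` U) (psi w) by rewrite UK.
      by move=> [v Uv /psi_inj <-].
- move=> triv; apply: ntK; rewrite -phi_g -psi_K => _ _ [u _ <-] [w _ <-].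
  by split; [rewrite -actE triv linear0 | apply: asK].
exists f => [|a b]; first by exists theta.
rewrite -[a in LHS]fK -[b in LHS]fK; case: (f a) (f b) => [u w] [u' w'].
rewrite !thetaE linearDl !linearDr [mul (psi w) _]Leib_mull // [mul (psi w)
  _]Leib_mull //.
by rewrite !addr0 -brE -actE -thetaE thetaK.
Qed.

Lemma simple_lie_simple_leibniz (F : fieldType) (L : lmodType F)
    (mul : {bilinear L -> L -> L}) :
  simple_lie mul [set: L] -> simple_leibniz mul.
Proof.
move=> [[_ xx _] [x [y [_ _ xy0]]] idL].
have K0 : Leib mul = [set 0].
  apply: set0_eq => [|z]; first exact: subspace0 (Leib_subspace mul).
  move: z; apply: linspan_sub; last by move=> _ [z _ <-]; apply: xx.
  by apply/subspaceP; split=> // a u v -> ->; rewrite scaler0 addr0.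
split=> [I /idL[->|->]|]; first by rewrite -K0; constructor 2.
  by constructor 3.
rewrite K0; split=> [_ ->|D0]; first exact: subspace0 (linspan_subspace _).
by apply: xy0; apply: D0; apply: derived_mul.
Qed.

Section HemiSemidirectSimple.
Variables (F : fieldType) (L g M : lmodType F).
Variables (mul : {bilinear L -> L -> L}) (br : {bilinear g -> g -> g}).
Variables (act : {bilinear g -> M -> M}) (f : {linear L -> (g * M)%type}).
Hypotheses (simg : simple_lie br [set: g]).
Hypotheses (irrM : irreducible_left_module br act).
Hypotheses (ntM : ~ trivial_left_module act).
Hypotheses (bf : bijective f).
Hypotheses (fM : forall x y, f (mul x y) = hemi_semidirect br act (f x) (f y)).

Lemma submodule_full (S : set M) : subspace S ->
  (forall x m, S (act x m)) -> S = [set: M].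
Proof.
move=> sS Sact; have [_ _ irr] := irrM.
have [//|S0|//] := irr S sS.
by case: ntM => x m; have := Sact x m; rewrite S0.
Qed.

Lemma hemi_semidirect_simple_leibniz : simple_leibniz mul.
Proof.
have [h0 fK h0K] := bf; have lh := can2_linear fK h0K.
pose h : {linear (g * M)%type -> L} := linear_pack lh.
have hK : cancel h f by []. have {}fK : cancel f h by [].
have hM u v : mul (h u) (h v) = h (br u.1 v.1, act u.1 v.2).
  by rewrite -[LHS]fK fM !hK.
have [[_ xx _] [x0 [y0 [_ _ xy0]]] idg] := simg.
pose N : set L := [set x | (f x).1 = 0].
have sN : subspace N.
  apply/subspaceP; split=> [|a u v Nu Nv]; rewrite /N /= ?linear0 //.
  by rewrite linearP /= Nu Nv scaler0 addr0.
have hE x : x = h ((f x).1, 0) + h (0, (f x).2).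
  rewrite -linearD -{1}[x]fK; congr (h _); case: (f x) => u w /=.
  by congr pair; rewrite /= ?addr0 ?add0r.
have Nh x : N x -> x = h (0, (f x).2).
  by rewrite /N /= => Nx; rewrite {1}[x]hE Nx linear0 add0r.
pose S (I : set L) : set M := [set m | I (h (0, m))].
have sS I : subspace I -> subspace (S I).
  move=> sI; apply/subspaceP; split=> [|a u v Su Sv]; rewrite /S /=.
    by rewrite linear0; apply: subspace0.
  rewrite (_ : (0, _) = a *: (0, u) + (0, v)) ?linearP.
    by case/subspaceP: sI => _; apply.
  by congr pair; rewrite /= ?scaler0 ?addr0.
have SN I : S I = [set: M] -> N `<=` I.
  move=> ST x /Nh->; have : S I (f x).2 by rewrite ST.
  by [].
have KN : Leib mul = N.
  apply/seteqP; split.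
    by apply: linspan_sub => // _ [x _ <-]; rewrite /N /= fM /= xx.
  apply: (SN (Leib mul)); apply: submodule_full => [|x m].
    exact/sS/Leib_subspace.
  rewrite /S /= (_ : h (0, _) = mul (h (x, m)) (h (x, m)));
    first exact: Leib_sqr.
  by rewrite hM /= xx.
split; last first.
  rewrite KN; split=> [|DN]; last first.
    by apply: xy0;
      have := DN _ (@derived_mul _ _ mul (h (x0, 0)) (h (y0, 0)));
      rewrite /N /= hM hK.
  rewrite -KN; apply: linspan_sub; first exact: linspan_subspace.
  by move=> _ [x _ <-]; apply: derived_mul.
move=> I [sI _ II].
pose I1 : set g := [set (f x).1 | x in I].
have /idg[I10|I1T] : ideal br [set: g] I1.
  split=> //.
    apply/subspaceP; split=> [|a _ _ [u Iu <-] [v Iv <-]].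
      by exists 0; [apply: subspace0 | rewrite linear0].
    exists (a *: u + v); last by rewrite linearP.
    by case/subspaceP: sI => _; apply.
  move=> x _ _ [y Iy <-]; have [xy yx] := II (h (x, 0)) y Logic.I Iy.
  by split; [exists (mul (h (x, 0)) y)|exists (mul y (h (x, 0)))];
    rewrite // fM hK.
- have IN : I `<=` N.
    by move=> x Ix; have : I1 (f x).1 by [exists x]; rewrite I10.
  have [_ _ irr] := irrM; have [||S0|ST] := irr (S I); first exact: sS.
  + move=> x m Sm; rewrite /S /=.
    rewrite (_ : h (0, _) = mul (h (x, 0)) (h (0, m))).
      by have [] := II (h (x, 0)) _ Logic.I Sm.
    by rewrite hM /= linear0r.
  + constructor 1; apply: set0_eq => [|x Ix]; first exact: subspace0.
    have xE := Nh _ (IN _ Ix); have : S I (f x).2 by rewrite /S /= -xE.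
    by rewrite S0 /= => m0; rewrite xE m0 linear0.
  + constructor 2; rewrite KN; apply/seteqP; split=> //; exact: SN.
- constructor 3; apply/seteqP; split=> // x _.
  have ST : S I = [set: M].
    apply: submodule_full => [|y m]; first exact: sS.
    have [z Iz zy] : I1 y by rewrite I1T.
    rewrite /S /= (_ : h (0, _) = mul z (h (0, m))).
      by have [] := II (h (0, m)) _ Logic.I Iz.
    by rewrite -[z]fK hM /= zy linear0r.
  have [z Iz zx] : I1 (f x).1 by rewrite I1T.
  rewrite -[x](subrK z); apply: subspaceD => //; apply: (SN _ ST).
  by rewrite /N /= linearB /= zx subrr.
Qed.

Lemma hemi_semidirect_finite_dim :
  finite_dim [set: g] -> finite_dim [set: M] -> finite_dim [set: L].
Proof.
move=> /finite_dim_parametrization[a [phi [_ phiT]]].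
move=> /finite_dim_parametrization[b [psi [_ psiT]]].
have [h fK hK] := bf; have lh := can2_linear fK hK.
have lt : linear (fun v : 'rV[F]_(a + b) =>
    linear_pack lh (phi (lsubmx v), psi (rsubmx v))).
  move=> c u v; rewrite -linearP; congr (linear_pack lh _).
  by congr pair; rewrite /= !linearP.
suff -> : [set: L] = range (linear_pack lt) by apply: range_finite_dim.
apply/seteqP; split=> // x _.
have [u _ uE] : range phi (f x).1 by rewrite phiT.
have [w _ wE] : range psi (f x).2 by rewrite psiT.
exists (row_mx u w) => //; rewrite /= /linear_pack row_mxKl row_mxKr uE wE.
by rewrite -surjective_pairing fK.
Qed.

End HemiSemidirectSimple.

Theorem theorem3p3 (F : fieldType) (charF0 : [pchar F] =i pred0)
    (L : lmodType F) (mul : {bilinear L -> L -> L})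
    (mulL : left_leibniz mul) :
  [<-> finite_dim [set: L] /\ simple_leibniz mul;

       exists g : set L,
         [/\ finite_dim g, simple_lie mul g, direct_sum g (Leib mul)
           & Leib mul = [set 0] \/
             [/\ finite_dim (Leib mul),
                 irreducible_bimodule mul g (Leib mul) mul mul,
                 antisymmetric_bimodule g (Leib mul) mul
               & ~ trivial_bimodule g (Leib mul) mul mul]];

       (finite_dim [set: L] /\ simple_lie mul [set: L]) \/
       exists (g M : lmodType F)
              (br : {bilinear g -> g -> g}) (act : {bilinear g -> M -> M}),
         [/\ finite_dim [set: g] /\ simple_lie br [set: g],
             finite_dim [set: M] /\ irreducible_left_module br act,
             ~ trivial_left_module act
           & algebra_iso mul (hemi_semidirect br act)]].
Proof.
split; first by case=> fdL simL; apply: simple_leibniz_decomposition.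
split.
  by move=> [g [fdg simg dec gK]]; apply: decomposition_hemi_semidirect dec gK.
move=> [[fdL simL]|[g [M [br [act [[fdg simg] [fdM irrM] ntM [f bf fM]]]]]]].
  by split=> //; apply: simple_lie_simple_leibniz.
by split; [apply: hemi_semidirect_finite_dim bf fdg fdM
          |apply: hemi_semidirect_simple_leibniz simg irrM ntM bf fM].
Qed.
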